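(* Let $\mathcal H$ be a Hilbert space and let $A,B$ be bounded linear operators on $\mathcal H$ such that $0<m\le A,B\le M$ for scalars $m,M$. Let $0\le t\le 1$. Then \[A\natural_t B\le \frac{1}{K\left(\frac{m}{M},\frac{M}{m},t\right)}\,\frac{\left(M^{1+t}+m^{1+t}\right)^2}{4M^{1+t}m^{1+t}}\,A\sharp_t B.\]
   Context: For real scalars, $m\le A\le M$ means $mI\le A\le MI$ in the usual order on self-adjoint operators ($A\ge B$ iff $A-B$ is positive semi-definite); ''$m\le A,B\le M$'' means this holds for both $A$ and $B$. For positive definite $A,B$ and $0\le t\le 1$, the weighted geometric mean is $A\sharp_t B=A^{1/2}(A^{-1/2}BA^{-1/2})^{t}A^{1/2}$, $A\sharp B=A\sharp_{1/2}B$, and the weighted spectral geometric mean is $A\natural_t B=(A^{-1}\sharp B)^{t}A(A^{-1}\sharp B)^{t}$. The generalized Kantorovich constant is, for $0<a<b$ and $t\in\mathbb R$, \[K(a,b,t)=\frac{ab^t-ba^t}{(t-1)(b-a)}\left(\frac{t-1}{t}\,\frac{b^t-a^t}{ab^t-ba^t}\right)^t,\] with the value $1$ (the limiting value) when $t\in\{0,1\}$ or $a=b$. *)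

(* Defs.v *)
From HB Require Import structures.
From mathcomp Require Import all_boot all_order all_algebra.
From mathcomp Require Import complex.
From mathcomp Require Import all_classical all_reals all_analysis.

Set Implicit Arguments.
Unset Strict Implicit.
Unset Printing Implicit Defensive.

Import Order.TTheory GRing.Theory Num.Theory.
Import numFieldNormedType.Exports.

Local Open Scope classical_set_scope.
Local Open Scope complex_scope.
Local Open Scope ring_scope.

Section BoundedOperators.
Context {R : realType} {H : completeNormedModType R[i]}.
Implicit Types S T : H -> H.

(* A Hilbert space is a complete normed complex space whose norm is induced
   by an inner product (linear in its first argument). *)
Definition induces_norm (dot : {dot H for Num.conj}) : Prop :=
  forall x, `|x| ^+ 2 = dot x x.

Definition bounded_op T : Prop :=
  linear T /\ exists k : R, forall x, `|T x| <= k%:C * `|x|.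

Definition self_adjoint (dot : {dot H for Num.conj}) T : Prop :=
  forall x y, dot (T x) y = dot x (T y).

(* In R[i], [0 <= z] means that z is real and nonnegative. *)
Definition psd (dot : {dot H for Num.conj}) T : Prop :=
  self_adjoint dot T /\ forall x, 0 <= dot (T x) x.

Definition op_le (dot : {dot H for Num.conj}) S T : Prop :=
  psd dot (T - S).

Definition is_inverse T S : Prop :=
  bounded_op S /\ (forall x, S (T x) = x) /\ (forall x, T (S x) = x).

(* The inverse of T, or 0 if T is not boundedly invertible. *)
Definition op_inv T : H -> H := xget (0 : H -> H) [set S | is_inverse T S].

Definition spectrum T : set R[i] :=
  [set z | ~ exists S, is_inverse (T - z *: (idfun : H -> H)) S].

Definition poly_op (p : {poly R}) T : H -> H :=
  fun x => \sum_(i < size p) (p`_i)%:C *: iter i T x.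

Definition op_norm_cvg (T_ : nat -> H -> H) T : Prop :=
  forall e : R, 0 < e ->
    \forall n \near \oo, forall x, `|T_ n x - T x| <= e%:C * `|x|.

(* Continuous functional calculus of a self-adjoint operator T: S = f(T) is
   the operator-norm limit of p_n(T), for real polynomials p_n converging to f
   uniformly on the spectrum of T, which is then a subset of the real line. *)
Definition is_fun_calc (f : R -> R) T S : Prop :=
  bounded_op S /\
  exists p : nat -> {poly R},
    (forall e : R, 0 < e ->
       \forall n \near \oo, forall r : R,
         spectrum T r%:C -> `|(p n).[r] - f r| <= e) /\
    op_norm_cvg (fun n => poly_op (p n) T) S.

(* f(T) (unique for self-adjoint T), or 0 if it does not exist. *)
Definition fun_calc (f : R -> R) T : H -> H :=
  xget (0 : H -> H) [set S | is_fun_calc f T S].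

(* Meant for positive definite T, whose spectrum lies in some [a, b], 0 < a. *)
Definition op_pow T (t : R) : H -> H := fun_calc (fun r => r `^ t) T.

Definition gmean (t : R) (A B : H -> H) : H -> H :=
  op_pow A 2^-1 \o
  op_pow (op_pow A (- 2^-1) \o B \o op_pow A (- 2^-1)) t \o
  op_pow A 2^-1.

Definition spectral_gmean (t : R) (A B : H -> H) : H -> H :=
  let G := gmean 2^-1 (op_inv A) B in
  op_pow G t \o A \o op_pow G t.

End BoundedOperators.

(* Generalized Kantorovich constant, for 0 < a <= b. *)
Definition kantorovich {R : realType} (a b t : R) : R :=
  if [|| t == 0, t == 1 | a == b] then 1
  else (a * b `^ t - b * a `^ t) / ((t - 1) * (b - a)) *
       ((t - 1) / t * ((b `^ t - a `^ t) / (a * b `^ t - b * a `^ t))) `^ t.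

(* Main.v *)
(** Kantorovich constants enter twice, and quadratic forms carry the argument.
    Put [G = A^-1 # B], so that [G A G = B], [A nat_t B = G^t A G^t] and
    [sqrt (m / M) <= G <= sqrt (M / m)].
    - [A^(1/2) G^t A^(1/2)] has condition number [(M / m)^(1 + t)], so the
      Kantorovich inequality at [A^(-1/2) x] gives
      [<G^t A G^t x, x> <A^-1 x, x> <= kappa <G^t x, x>^2].
    - By concavity [<G^t x, x> <= <G x, x>^t |x|^(2 (1 - t))], and by
      Cauchy-Schwarz [<G x, x>^2 <= <A^-1 x, x> <B x, x>] and
      [|x|^4 <= <A x, x> <A^-1 x, x>], whence
      [<G^t A G^t x, x> <= kappa <B x, x>^t <A x, x>^(1 - t)].
    - The chord of [r^t] over [[m / M, M / m]] gives
      [<(A #_t B) x, x> >= K <B x, x>^t <A x, x>^(1 - t)].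
    The functional calculus rests on one fact: a real polynomial that is
    nonnegative on the spectrum of [T] yields a positive operator. If [c < 0]
    were the lower bound of the form of [p(T)], then [p - c] would have no root
    in the spectrum, so [p(T) - c] would be invertible, hence coercive, and [c]
    could be raised. *)
Require Import Defs.
From HB Require Import structures.
From mathcomp Require Import all_boot all_order all_algebra.
From mathcomp Require Import complex ring lra.
From mathcomp Require Import all_classical all_reals all_analysis.

Import Order.TTheory GRing.Theory Num.Theory.
Import numFieldNormedType.Exports.

Local Open Scope classical_set_scope.
Local Open Scope complex_scope.
Local Open Scope ring_scope.

Set Implicit Arguments.
Unset Strict Implicit.
Unset Printing Implicit Defensive.

(** * Real inner product *)

Section RealStructure.
Context {R : realType} {H : completeNormedModType R[i]}.
Variable dot : {dot H for Num.conj}.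
Implicit Types (x y z : H) (a b c d : R) (S T U : H -> H).

(** Norms take values in [R[i]]. Passing to real parts, here and in [ip], moves every estimate into
    the ordered field [R]. *)
Definition nr x : R := complex.Re `|x|.

Definition ip x y : R := complex.Re (dot x y).

Lemma nrE x : `|x| = (nr x)%:C.
Proof.
rewrite /nr; have: 0 <= `|x| by exact: normr_ge0.
by case: (`|x|) => u v; rewrite lecE /= => /andP[/eqP -> _].
Qed.

Lemma nr_ge0 x : 0 <= nr x.
Proof. by rewrite -ler0c -nrE. Qed.

Lemma nrD x y : nr (x + y) <= nr x + nr y.
Proof. by rewrite -lecR rmorphD /= -!nrE ler_normD. Qed.

Lemma nr0 : nr 0 = 0.
Proof. by rewrite /nr normr0. Qed.

Lemma nr0_eq0 x : nr x = 0 -> x = 0.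
Proof. by move=> x0; apply/eqP; rewrite -normr_eq0 nrE x0. Qed.

Lemma nrZ (z : R[i]) x : nr (z *: x) = complex.Re `|z| * nr x.
Proof.
rewrite /nr normrZ nrE; have: 0 <= `|z| by exact: normr_ge0.
by case: (`|z|) => u v; rewrite lecE /= => /andP[/eqP -> _]; rewrite mulr0 subr0.
Qed.

Lemma nrN x : nr (- x) = nr x.
Proof. by rewrite /nr normrN. Qed.

Lemma nrB x y : nr (x - y) = nr (y - x).
Proof. by rewrite -nrN opprB. Qed.

Lemma ipDl x y z : ip (x + y) z = ip x z + ip y z.
Proof. by rewrite /ip linearDl raddfD. Qed.

Lemma ipDr x y z : ip x (y + z) = ip x y + ip x z.
Proof. by rewrite /ip linearDr raddfD. Qed.

Lemma ipZl a x y : ip (a%:C *: x) y = a * ip x y.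
Proof. by rewrite /ip linearZl_LR /=; case: (dot x y) => u v /=; rewrite mul0r subr0. Qed.

Lemma ipC x y : ip x y = ip y x.
Proof. by rewrite /ip hermC /= expr0 mul1r; case: (dot y x). Qed.

Lemma ipZr a x y : ip x (a%:C *: y) = a * ip x y.
Proof. by rewrite ipC ipZl ipC. Qed.

Lemma ipNl x y : ip (- x) y = - ip x y.
Proof. by rewrite /ip linearNl raddfN. Qed.

Lemma ipNr x y : ip x (- y) = - ip x y.
Proof. by rewrite ipC ipNl ipC. Qed.

Lemma ipBl x y z : ip (x - y) z = ip x z - ip y z.
Proof. by rewrite ipDl ipNl. Qed.

Lemma ipBr x y z : ip x (y - z) = ip x y - ip x z.
Proof. by rewrite ipDr ipNr. Qed.

Lemma ip0l x : ip 0 x = 0. Proof. by rewrite -(subrr 0) ipBl subrr. Qed.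

Lemma ip0r x : ip x 0 = 0. Proof. by rewrite ipC ip0l. Qed.

Definition ipE := (ipDl, ipDr, ipNl, ipNr, ipZl, ipZr).

(** The real form determines [dot], so a linear operator that is symmetric for [ip] is symmetric for
    [dot]. *)
Lemma dotE x y : dot x y = (ip x y) +i* (ip x ('i%C *: y)).
Proof.
rewrite /ip linearZr_LR /=.
have -> : ('i%C)^* = - 'i%C :> R[i] by rewrite complexiE conjCi.
by case: (dot x y) => u v /=; rewrite oppr0 mul0r mulN1r sub0r opprK.
Qed.

Hypothesis dotH : induces_norm dot.

Lemma ipxx x : ip x x = nr x ^+ 2.
Proof. by rewrite /ip -dotH nrE -rmorphXn. Qed.

Lemma ip_ge0 x : 0 <= ip x x.
Proof. by rewrite ipxx sqr_ge0. Qed.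

Lemma ip_eq0 x : ip x x = 0 -> x = 0.
Proof. by rewrite ipxx => /eqP; rewrite sqrf_eq0 => /eqP /nr0_eq0. Qed.

Lemma nr_le_of_ip_le c x y : 0 <= c -> ip x x <= c ^+ 2 * ip y y -> nr x <= c * nr y.
Proof.
move=> c0; rewrite !ipxx -exprMn ler_sqr ?nnegrE ?nr_ge0//.
by rewrite mulr_ge0 ?nr_ge0.
Qed.

Lemma ip_le_of_nr_le c x y : 0 <= c -> nr x <= c * nr y -> ip x x <= c ^+ 2 * ip y y.
Proof.
move=> c0 h; rewrite !ipxx -exprMn ler_sqr ?nnegrE ?nr_ge0//.
by rewrite mulr_ge0 ?nr_ge0.
Qed.

Lemma quadratic_ge0_discriminant (u v w : R) : 0 <= w ->
  (forall s : R, 0 <= u + 2 * s * v + s ^+ 2 * w) -> v ^+ 2 <= u * w.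
Proof.
move=> w0 h; have [w00|wn0] := eqVneq w 0.
  have [->|v0] := eqVneq v 0; first by rewrite w00 mulr0 expr0n.
  (* With [w = 0] the expression is affine in [s], and this [s] gives it the value [-1]. *)
  have := h (- (u + 1) / (2 * v)); rewrite w00 mulr0 addr0.
  have -> : u + 2 * (- (u + 1) / (2 * v)) * v = -1 by field; rewrite v0.
  by rewrite ler0N1.
have wp : 0 < w by rewrite lt_neqAle eq_sym wn0.
(* The minimizer of the quadratic. *)
have := h (- v / w).
have -> : u + 2 * (- v / w) * v + (- v / w) ^+ 2 * w = u - v ^+ 2 / w by field.
by rewrite subr_ge0 ler_pdivrMr.
Qed.

Lemma ip_CauchySchwarz x y : ip x y ^+ 2 <= ip x x * ip y y.
Proof.
apply: quadratic_ge0_discriminant; first exact: ip_ge0.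
by move=> s; have := ip_ge0 (x + s%:C *: y); rewrite !ipE (ipC y x); lra.
Qed.

Lemma ip_le_nrM x y : ip x y <= nr x * nr y.
Proof.
have h := ip_CauchySchwarz x y; rewrite !ipxx -exprMn in h.
apply: le_trans (ler_norm _) _.
rewrite -(ger0_norm (mulr_ge0 (nr_ge0 x) (nr_ge0 y))).
by rewrite -ler_sqr ?nnegrE// !real_normK ?num_real.
Qed.

End RealStructure.

(** * Bounded operators *)

Section Operators.
Context {R : realType} {H : completeNormedModType R[i]}.
Implicit Types (x y z : H) (a b c d : R) (S T U : H -> H).

Lemma linZ T (Tl : linear T) (z : R[i]) x : T (z *: x) = z *: T x.
Proof.
have T0 : T 0 = 0.
  by have := Tl 1 0 0; rewrite !scale1r addr0 => /eqP; rewrite -subr_eq subrr eq_sym => /eqP.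
by have := Tl z x 0; rewrite !addr0 T0 addr0.
Qed.

Lemma linD T (Tl : linear T) x y : T (x + y) = T x + T y.
Proof. by have := Tl 1 x y; rewrite !scale1r. Qed.

Lemma lin0 T (Tl : linear T) : T 0 = 0.
Proof. by have := linZ Tl 0 0; rewrite !scale0r. Qed.

Lemma linN T (Tl : linear T) x : T (- x) = - T x.
Proof. by rewrite -scaleN1r linZ// scaleN1r. Qed.

Lemma linB T (Tl : linear T) x y : T (x - y) = T x - T y.
Proof. by rewrite linD// linN. Qed.

Lemma lin_sum T (Tl : linear T) (I : Type) (r : seq I) (P : pred I) (F : I -> H) :
  T (\sum_(i <- r | P i) F i) = \sum_(i <- r | P i) T (F i).
Proof. by apply: (big_morph T (linD Tl) (lin0 Tl)). Qed.

Lemma bop_lin T : bounded_op T -> linear T. Proof. by case. Qed.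

Lemma bopP T : bounded_op T <->
  linear T /\ exists2 k : R, 0 < k & forall x, nr (T x) <= k * nr x.
Proof.
split=> -[Tl [k hk]]; split=> //.
  exists (`|k| + 1); first by rewrite ltr_wpDl.
  move=> x; have := hk x; rewrite !nrE -rmorphM lecR => /le_trans; apply.
  by rewrite ler_wpM2r ?nr_ge0// (le_trans (ler_norm k))// lerDl.
by exists k => x; rewrite !nrE -rmorphM lecR.
Qed.

Lemma complex_Re_norm_ge0 (z : R[i]) : 0 <= complex.Re `|z|.
Proof. by rewrite normc_def /= sqrtr_ge0. Qed.

Lemma bop_id : bounded_op (idfun : H -> H).
Proof.
by apply/bopP; split=> [a x y //|]; exists 1 => // x; rewrite mul1r.
Qed.

Lemma bop_comp S T : bounded_op S -> bounded_op T -> bounded_op (S \o T).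
Proof.
move=> /bopP[Sl [k k0 hk]] /bopP[Tl [l l0 hl]]; apply/bopP; split.
  by move=> a x y; rewrite /= Tl Sl.
exists (k * l); first exact: mulr_gt0.
move=> x /=; apply: le_trans (hk _) _.
by rewrite -mulrA ler_wpM2l// ltW.
Qed.

Lemma bopD S T : bounded_op S -> bounded_op T -> bounded_op (S + T).
Proof.
move=> /bopP[Sl [k k0 hk]] /bopP[Tl [l l0 hl]]; apply/bopP; split.
  by move=> a x y; rewrite !addrfctE /= Tl Sl scalerDr addrACA.
exists (k + l); first exact: addr_gt0.
by move=> x; rewrite addrfctE (le_trans (nrD _ _))// mulrDl lerD.
Qed.

Lemma bopZ (z : R[i]) T : bounded_op T -> bounded_op (z *: T).
Proof.
move=> /bopP[Tl [l l0 hl]]; apply/bopP; split.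
  by move=> a x y; rewrite !scalrfctE Tl scalerDr !scalerA (mulrC a).
have h : 0 <= complex.Re `|z| by exact: complex_Re_norm_ge0.
exists ((complex.Re `|z| + 1) * l); first by rewrite mulr_gt0// ltr_wpDl.
move=> x; rewrite scalrfctE nrZ -mulrA ler_pM ?nr_ge0//.
by rewrite lerDl.
Qed.

Lemma bopN T : bounded_op T -> bounded_op (- T).
Proof. by move=> Tb; rewrite -scaleN1r; exact: bopZ. Qed.

Lemma bopB S T : bounded_op S -> bounded_op T -> bounded_op (S - T).
Proof. by move=> Sb Tb; apply: bopD => //; exact: bopN. Qed.

Lemma bop_shift T (z : R[i]) : bounded_op T -> bounded_op (T - z *: (idfun : H -> H)).
Proof. by move=> Tb; apply: bopB => //; apply: bopZ; exact: bop_id. Qed.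

Lemma shiftE T (z : R[i]) x : (T - z *: (idfun : H -> H)) x = T x - z *: x.
Proof. by []. Qed.

(** * Completeness, Neumann series and inverses *)

Lemma nr_cauchy (u : nat -> H) :
  (forall e : R, 0 < e -> exists N, forall m n, (N <= m)%N -> (N <= n)%N ->
     nr (u m - u n) <= e) ->
  exists l, forall e : R, 0 < e -> exists N, forall n, (N <= n)%N ->
     nr (u n - l) <= e.
Proof.
move=> uC.
have pos (e : R[i]) : 0 < e -> exists2 r : R, 0 < r & e = r%:C.
  by case: e => p q; rewrite ltcE /= => /andP[/eqP -> p0]; exists p.
have : cvg (u @ \oo).
  apply: cauchy_cvg; apply: cauchy_exP => e /pos[r r0 ->].
  have [N hN] := uC (r / 2) (divr_gt0 r0 (ltr0Sn _ 1)).
  exists (u N), N => // n /= Nn; rewrite -ball_normE /= nrE ltcR.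
  by rewrite (le_lt_trans (hN N n (leqnn _) Nn))// ltr_pdivrMr// ltr_pMr// ltr1n.
move=> /cvgrPdist_le /= h; exists (lim (u @ \oo)) => e e0.
have [|N _ hN] := h e%:C; first by rewrite ltcR.
by exists N => n Nn; have := hN n Nn; rewrite nrE lecR nrB.
Qed.

Lemma geo_small (r C e : R) : 0 <= r -> r < 1 -> 0 < e ->
  exists N, forall n, (N <= n)%N -> r ^+ n * C <= e.
Proof.
move=> r0 r1 e0.
have h : (fun n => r ^+ n * C) @ \oo --> 0.
  by rewrite -(mul0r C); apply: cvgMl; apply: cvg_expr; rewrite ger0_norm.
have /cvgrPdist_le/(_ e e0)[N _ hN] := h.
exists N => n /hN; rewrite /= sub0r normrN => /(le_trans _); apply.
exact: ler_norm.
Qed.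

(* Partial sums of the Neumann series. *)
Lemma affine_fixpoint (Z : H -> H) (v : H) r : linear Z -> 0 <= r -> r < 1 ->
  (forall x, nr (Z x) <= r * nr x) -> exists l, Z l + v = l.
Proof.
move=> Zl r0 r1 hZ; pose u n := iter n (fun x => Z x + v) 0.
(* Consecutive iterates differ by [Z^n v]; the next bound sums these differences as a geometric
   series. *)
have d n : nr (u n.+1 - u n) <= r ^+ n * nr v.
  elim: n => [|n IH]; first by rewrite /u /= (lin0 Zl) add0r subr0 expr0 mul1r.
  rewrite [u n.+2]iterS [in X in _ - X]/u iterS -/(u n) -/(u n.+1).
  rewrite opprD addrACA subrr addr0 -linB//.
  by rewrite (le_trans (hZ _))// exprS -mulrA ler_wpM2l.
have q0 : 0 < 1 - r by rewrite subr_gt0.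
have dd n m : nr (u (n + m)%N - u n) <= (r ^+ n - r ^+ (n + m)) / (1 - r) * nr v.
  elim: m => [|m IH]; first by rewrite addn0 !subrr nr0 mul0r mul0r.
  rewrite addnS -(subrKA (u (n + m)%N)) (le_trans (nrD _ _))//.
  apply: le_trans (lerD (d _) IH) _.
  by rewrite exprS le_eqVlt; apply/orP; left; apply/eqP; field; rewrite gt_eqF.
have [e0|l hl] := @nr_cauchy u.
  move=> e0p; have [|N hN] := @geo_small r (2 * nr v / (1 - r)) e0 r0 r1; first exact: e0p.
  have hd n : (N <= n)%N -> nr (u n - u N) <= e0 / 2.
    move=> Nn; have := dd N (n - N)%N; rewrite subnKC// => /le_trans; apply.
    have := hN N (leqnn N).
    have -> : r ^+ N * (2 * nr v / (1 - r)) = 2 * (r ^+ N / (1 - r) * nr v).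
      by field; rewrite gt_eqF.
    move=> hh; rewrite ler_pdivlMr// mulrC (le_trans _ hh)// ler_pM2l//.
    by rewrite ler_wpM2r ?nr_ge0// ler_wpM2r ?invr_ge0 ?(ltW q0)// gerBl exprn_ge0.
  exists N => m n Nm Nn; rewrite -(subrKA (u N)) (le_trans (nrD _ _))//.
  by have := hd _ Nm; have := hd _ Nn; rewrite (nrB (u n)); lra.
(* The limit is a fixed point: [Z l + v] and [l] are both close to [u N.+1 = Z (u N) + v]. *)
exists l; apply/eqP; rewrite -subr_eq0; apply/eqP/nr0_eq0/eqP.
rewrite eq_le nr_ge0 andbT; apply/ler_addgt0Pr => e e0; rewrite add0r.
have [N hN] := hl (e / 2) (divr_gt0 e0 (ltr0Sn _ 1)).
have h1 := hN N (leqnn _); have h2 := hN N.+1 (leqnSn _).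
rewrite -(subrKA (u N.+1)) (le_trans (nrD _ _))//.
suff : nr (Z l + v - u N.+1) <= e / 2 by lra.
rewrite /u iterS -/(u N) opprD addrACA subrr addr0 -linB//.
rewrite (le_trans (hZ _))// nrB (le_trans _ h1)// ler_piMl ?nr_ge0//.
exact: ltW.
Qed.

(** The lower bound makes [T] injective and bounds the inverse by [c^-1]. *)
Lemma inverse_surj T c : linear T -> 0 < c ->
  (forall x, c * nr x <= nr (T x)) -> (forall y, exists x, T x = y) ->
  exists S, is_inverse T S.
Proof.
move=> Tl c0 hc /choice[S hS].
have Ti x y : T x = T y -> x = y.
  move=> e; apply/eqP; rewrite -subr_eq0; apply/eqP/nr0_eq0/eqP.
  rewrite eq_le nr_ge0 andbT -(pmulr_rle0 _ c0) (le_trans (hc _))//.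
  by rewrite linB// e subrr nr0.
exists S; split; last by split=> // x; apply: Ti; rewrite hS.
apply/bopP; split; first by move=> a x y; apply: Ti; rewrite Tl !hS.
by exists c^-1; rewrite ?invr_gt0// => x; rewrite mulrC ler_pdivlMr// mulrC -{2}(hS x).
Qed.

Lemma is_inverse_uniq T S S' : is_inverse T S -> is_inverse T S' -> S = S'.
Proof.
move=> [_ [_ h1]] [_ [h2 _]]; apply/funext => x.
by rewrite -[in LHS](h2 (S x)) h1.
Qed.

Lemma op_inv_eq T S : is_inverse T S -> op_inv T = S.
Proof.
move=> TS; rewrite /op_inv; case: xgetP => [S' _ h|/(_ S)/(_ TS)//].
exact: is_inverse_uniq h TS.
Qed.

Lemma is_inverse_comp T T' S S' : is_inverse T S -> is_inverse T' S' ->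
  is_inverse (T \o T') (S' \o S).
Proof.
move=> [bS [h1 h2]] [bS' [h3 h4]]; split; first exact: bop_comp.
by split=> x /=; rewrite ?h1 ?h3// h4 h2.
Qed.

End Operators.

(** * Spectrum of self-adjoint operators *)

Section SelfAdjoint.
Context {R : realType} {H : completeNormedModType R[i]}.
Variable dot : {dot H for Num.conj}.
Hypothesis dotH : induces_norm dot.
Implicit Types (x y z : H) (a b c d : R) (S T U : H -> H).
Local Notation ip := (ip dot).

(** Symmetry for the real form only; for linear operators [self_adjointP] shows that it agrees with
    [self_adjoint]. *)
Definition sadj T := forall x y, ip (T x) y = ip x (T y).

(* Polarization at the vectors [x] and [d^-1 Z x]. *)
Lemma sadj_norm Z d : linear Z -> sadj Z -> 0 < d ->
  (forall x, `|ip (Z x) x| <= d * ip x x) -> forall x, nr (Z x) <= d * nr x.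
Proof.
move=> Zl Zs d0 hZ x; apply: (nr_le_of_ip_le dotH); first exact: ltW.
have [y yD] : exists y, y = d^-1%:C *: Z x by eexists.
have h1 := le_trans (ler_norm _) (hZ (x + y)).
have h2 := hZ (x - y); rewrite ler_norml in h2; have /andP[h3 _] := h2.
move: h1 h3; rewrite linB// linD// !ipE.
have yE : ip (Z x) y = d^-1 * ip (Z x) (Z x) by rewrite yD ipZr.
have yx : ip (Z y) x = d^-1 * ip (Z x) (Z x) by rewrite Zs ipC yE.
have yy : ip y y = d^-1 ^+ 2 * ip (Z x) (Z x) by rewrite yD !ipE mulrA -expr2.
rewrite yE yx yy (ipC _ y x) => h1 h3.
(* The forms at [x + y] and [x - y] differ by four times [ip (Z x) y], and the parallelogram law
   gives [2 d (|x|^2 + |y|^2)] as a bound. *)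
have h4 : 4 * (d^-1 * ip (Z x) (Z x)) <=
    2 * d * ip x x + 2 * d * (d^-1 ^+ 2 * ip (Z x) (Z x)) by lra.
have h5 : 2 * d * (d^-1 ^+ 2 * ip (Z x) (Z x)) = 2 * (d^-1 * ip (Z x) (Z x)).
  by field; rewrite gt_eqF.
rewrite h5 in h4.
have : d^-1 * ip (Z x) (Z x) <= d * ip x x by lra.
by rewrite mulrC ler_pdivrMr// => /le_trans; apply; rewrite expr2; lra.
Qed.

Lemma form_le_norm T k : (forall x, nr (T x) <= k * nr x) ->
  forall x, ip (T x) x <= k * ip x x.
Proof.
move=> hk x; apply: le_trans (ip_le_nrM dotH _ _) _.
by rewrite ipxx// expr2 mulrA ler_wpM2r// nr_ge0.
Qed.

Lemma form_ge_norm T c : (forall x, c * ip x x <= ip (T x) x) ->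
  forall x, c * nr x <= nr (T x).
Proof.
move=> hc x; have := le_trans (hc x) (ip_le_nrM dotH _ _).
rewrite ipxx// expr2 mulrA; have [x0|x0] := eqVneq (nr x) 0.
  by rewrite x0 !mulr0 nr_ge0.
by rewrite ler_pM2r// lt_neqAle eq_sym x0 nr_ge0.
Qed.

(** The equation [T x = y] says that [x] is a fixed point of [x |-> Z x + y / b], where
    [Z = 1 - T / b] and [b = k + c]. The form of [Z] lies between [c / b] and [k / b], so [Z] is a
    contraction. *)
Lemma coercive_inverse T c : bounded_op T -> sadj T -> 0 < c ->
  (forall x, c * ip x x <= ip (T x) x) -> exists S, is_inverse T S.
Proof.
move=> /bopP[Tl [k k0 hk]] Ts c0 hc.
apply: (inverse_surj Tl c0); first exact: form_ge_norm.
move=> y; pose b := k + c; have b0 : 0 < b by exact: addr_gt0.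
pose Z x := x - b^-1%:C *: T x.
have Zl : linear Z.
  by move=> a u v; rewrite /Z Tl scalerDr opprD scalerA mulrC -scalerA scalerBr addrACA.
have Zs : sadj Z by move=> u v; rewrite /Z !ipE Ts.
have r0 : 0 < k / b by rewrite divr_gt0.
have hZ x : nr (Z x) <= k / b * nr x.
  apply: sadj_norm => // {}x; rewrite /Z !ipE.
  have h1 := hc x; have h2 := form_le_norm hk x.
  have h3 : b^-1 * ip (T x) x <= b^-1 * (k * ip x x) by rewrite ler_pM2l// invr_gt0.
  have h4 : b^-1 * (c * ip x x) <= b^-1 * ip (T x) x by rewrite ler_pM2l// invr_gt0.
  have h5 : b^-1 * (c * ip x x) = ip x x - k / b * ip x x.
    by rewrite /b; field; rewrite gt_eqF.
  have h6 : b^-1 * (k * ip x x) = k / b * ip x x by field; rewrite gt_eqF.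
  have h7 : 0 <= b^-1 * (c * ip x x).
    by rewrite mulr_ge0 ?invr_ge0 ?(ltW b0)// mulr_ge0 ?ip_ge0// ltW.
  rewrite ger0_norm; first by lra.
  by lra.
have r1 : k / b < 1 by rewrite ltr_pdivrMr// mul1r ltrDl.
have [l hl] := affine_fixpoint (b^-1%:C *: y) Zl (ltW r0) r1 hZ.
exists l; move/eqP: hl; rewrite /Z -addrA addrC -subr_eq0 addrK addrC -scalerBr.
have bn0 : (b^-1)%:C != 0 :> R[i] by rewrite fmorph_eq0 invr_eq0 gt_eqF.
by rewrite scaler_eq0 (negPf bn0) /= subr_eq0 => /eqP.
Qed.

Lemma complexD (u v : R) : u +i* v = u%:C + 'i%C * v%:C.
Proof. by rewrite [LHS]complexE. Qed.

Lemma sadj_shift T a : sadj T -> sadj (T - a%:C *: (idfun : H -> H)).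
Proof. by move=> Ts x y; rewrite !shiftE !ipE Ts. Qed.

(* For [z = u + i v] with [v <> 0],
   [(T - z) (T - z^* ) = (T - u)^2 + v^2] is coercive. *)
Lemma spectrum_real T (z : R[i]) : bounded_op T -> sadj T ->
  spectrum T z -> complex.Im z = 0.
Proof.
move=> Tb Ts; case: z => u v /= sz; apply/eqP/negPn/negP => v0; apply: sz.
have Tl := bop_lin Tb; set z := u +i* v.
set W := T - u%:C *: (idfun : H -> H).
have Wb : bounded_op W by exact: bop_shift.
have Wl := bop_lin Wb; have Ws : sadj W by exact: sadj_shift.
pose P := T - z *: (idfun : H -> H); pose P' := T - (u -i* v) *: (idfun : H -> H).
have PE x : P x = W x - ('i%C * v%:C) *: x.
  by rewrite /P /W !shiftE /z complexD scalerDl opprD addrA.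
have P'E x : P' x = W x + ('i%C * v%:C) *: x.
  by rewrite /P' /W !shiftE complexD rmorphN mulrN scalerDl opprD scaleNr opprK addrA.
have Pl : linear P by apply: bop_lin; exact: bop_shift.
have P'l : linear P' by apply: bop_lin; exact: bop_shift.
have sq : ('i%C * v%:C) * ('i%C * v%:C) = (- v ^+ 2)%:C :> R[i].
  by rewrite mulrACA -!expr2 sqr_i -rmorphXn mulN1r -rmorphN.
have PP' x : P (P' x) = W (W x) + (v ^+ 2)%:C *: x.
  rewrite PE P'E (linD Wl) (linZ Wl) (scalerDr _ (W x)) scalerA sq rmorphN scaleNr.
  by rewrite opprD opprK addrA addrK.
have P'P x : P' (P x) = W (W x) + (v ^+ 2)%:C *: x.
  rewrite P'E PE (linB Wl) (linZ Wl) (scalerBr _ (W x)) scalerA sq rmorphN scaleNr.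
  by rewrite opprK addrA subrK.
have v20 : 0 < v ^+ 2 by rewrite exprn_even_gt0.
have [|||S [Sb [S1 S2]]] :=
  @coercive_inverse (W \o W + (v ^+ 2)%:C *: (idfun : H -> H)) (v ^+ 2) _ _ v20.
- by apply: bopD; [exact: bop_comp|apply: bopZ; exact: bop_id].
- by move=> x y; rewrite !addrfctE !scalrfctE /= ipDl ipDr ipZl ipZr !Ws.
- move=> x; rewrite !addrfctE !scalrfctE /= ipDl ipZl Ws lerDr; exact: ip_ge0.
exists (P' \o S); split; first by apply: bop_comp => //; exact: bop_shift.
(* As [P] and [P'] commute, the inverse [S] of their product commutes with [P]; hence [P' S] is also
   a left inverse of [P]. *)
have C x : P (P' x) = P' (P x) by rewrite PP' P'P.
have S1' x : S (P (P' x)) = x by rewrite PP' -[RHS]S1.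
have S2' x : P (P' (S x)) = x by rewrite PP' -[RHS]S2.
split=> x //=; rewrite -/P.
  suff -> : S (P x) = P (S x) by rewrite -C S2'.
  by rewrite -[in LHS](S2' x) C S1'.
exact: S2'.
Qed.

(** For [r < a] the operator [T - r] is coercive, for [r > b] the operator [r - T] is; both are then
    invertible. *)
Lemma spectrum_itv T a b r : bounded_op T -> sadj T ->
  (forall x, a * ip x x <= ip (T x) x <= b * ip x x) ->
  spectrum T r%:C -> a <= r <= b.
Proof.
move=> Tb Ts hT sr; apply/andP; split; rewrite leNgt; apply/negP => h; apply: sr.
  apply: (@coercive_inverse _ (a - r)); rewrite ?subr_gt0//.
  - exact: bop_shift.
  - exact: sadj_shift.
  by move=> x; rewrite shiftE !ipE; have /andP[] := hT x; lra.
have [||||S [Sb [S1 S2]]] := @coercive_inverse (- (T - r%:C *: (idfun : H -> H))) (r - b).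
- by apply: bopN; exact: bop_shift.
- move=> x y; have := sadj_shift r Ts x y.
  by rewrite /= !opprfctE !ipE => ->.
- by rewrite subr_gt0.
- by move=> x; rewrite opprfctE shiftE !ipE; have /andP[] := hT x; lra.
exists (- S); split; first exact: bopN.
split=> x; rewrite opprfctE.
  rewrite -[RHS]S1 opprfctE linN//; exact: bop_lin Sb.
rewrite -[RHS]S2 opprfctE linN//; apply: bop_lin; exact: bop_shift.
Qed.

End SelfAdjoint.

(** * Polynomials of operators *)

Section PolyOp.
Context {R : realType} {H : completeNormedModType R[i]}.
Implicit Types (x y z : H) (S T U : H -> H) (p q : {poly R[i]}).

(** Complex coefficients allow the polynomial to be split into linear factors. *)
Definition cpoly_op p T : H -> H := fun x => \sum_(i < size p) p`_i *: iter i T x.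

Lemma poly_opE (p : {poly R}) T : poly_op p T = cpoly_op (map_poly (real_complex R) p) T.
Proof.
apply/funext => x; rewrite /poly_op /cpoly_op size_map_poly.
by apply: eq_bigr => i _; rewrite coef_map.
Qed.

Lemma cpoly_op_widen n p T x : (size p <= n)%N ->
  cpoly_op p T x = \sum_(i < n) p`_i *: iter i T x.
Proof.
move=> pn; rewrite /cpoly_op (big_ord_widen n (fun i => p`_i *: iter i T x))//.
rewrite big_mkcond; apply: eq_bigr => i _; case: ltnP => // /(nth_default 0) ->.
by rewrite scale0r.
Qed.

Lemma cpoly_opD p q T x : cpoly_op (p + q) T x = cpoly_op p T x + cpoly_op q T x.
Proof.
pose n := maxn (size p) (size q).
rewrite (@cpoly_op_widen n) ?size_polyD// (@cpoly_op_widen n p) ?leq_maxl//.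
rewrite (@cpoly_op_widen n q) ?leq_maxr// -big_split /=.
by apply: eq_bigr => i _; rewrite coefD scalerDl.
Qed.

Lemma cpoly_op0 T x : cpoly_op 0 T x = 0.
Proof. by rewrite /cpoly_op size_poly0 big_ord0. Qed.

Lemma cpoly_opZ (c : R[i]) p T x : cpoly_op (c *: p) T x = c *: cpoly_op p T x.
Proof.
rewrite (@cpoly_op_widen (size p)) ?size_scale_leq// scaler_sumr.
by apply: eq_bigr => i _; rewrite coefZ scalerA.
Qed.

Lemma cpoly_opC (c : R[i]) T x : cpoly_op c%:P T x = c *: x.
Proof. by rewrite (@cpoly_op_widen 1) ?size_polyC_leq1// big_ord1 coefC. Qed.

Lemma cpoly_opMX p T x : cpoly_op (p * 'X) T x = cpoly_op p T (T x).
Proof.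
rewrite (@cpoly_op_widen (size p).+1); last first.
  by rewrite (leq_trans (size_polyMleq _ _))// size_polyX addn2.
rewrite big_ord_recl coefMX /= scale0r add0r.
by apply: eq_bigr => i _; rewrite coefMX /= -iterS iterSr.
Qed.

Lemma cpoly_op_comm p T x : linear T -> cpoly_op p T (T x) = T (cpoly_op p T x).
Proof.
move=> Tl; rewrite /cpoly_op lin_sum//; apply: eq_bigr => i _.
by rewrite linZ// -iterSr.
Qed.

Lemma cpoly_opM p q T x : linear T ->
  cpoly_op (p * q) T x = cpoly_op p T (cpoly_op q T x).
Proof.
move=> Tl; elim/poly_ind: p => [|p c IH] in x *; first by rewrite mul0r !cpoly_op0.
rewrite mulrDl !cpoly_opD cpoly_opC mul_polyC cpoly_opZ cpoly_opMX; congr (_ + _).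
by rewrite -mulrA (mulrC 'X) mulrA cpoly_opMX IH cpoly_op_comm.
Qed.

Lemma cpoly_opXsubC (z : R[i]) T : cpoly_op ('X - z%:P) T = T - z *: (idfun : H -> H).
Proof.
apply/funext => x; rewrite -polyCN cpoly_opD cpoly_opC scaleNr; congr (_ + _).
by rewrite -['X]mul1r cpoly_opMX cpoly_opC scale1r.
Qed.

Lemma cpoly_op_bop p T : bounded_op T -> bounded_op (cpoly_op p T).
Proof.
move=> Tb; elim/poly_ind: p => [|p c IH].
  have -> : cpoly_op 0 T = 0 *: (idfun : H -> H).
    by apply/funext => x; rewrite cpoly_op0 scalrfctE scale0r.
  by apply: bopZ; exact: bop_id.
have -> : cpoly_op (p * 'X + c%:P) T = cpoly_op p T \o T + c *: (idfun : H -> H).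
  by apply/funext => x; rewrite cpoly_opD cpoly_opMX cpoly_opC.
by apply: bopD; [exact: bop_comp|apply: bopZ; exact: bop_id].
Qed.

(** Over the complex numbers [p (T)] is a nonzero multiple of a product of factors [T - z] with [z]
    a root of [p], each invertible because [z] is outside the spectrum. *)
Lemma cpoly_op_inverse p T : bounded_op T -> p != 0 ->
  (forall z : R[i], root p z -> ~ spectrum T z) -> exists S, is_inverse (cpoly_op p T) S.
Proof.
move=> Tb p0 hp; have [r pE] := closed_field_poly_normal p.
have hr (z : R[i]) : z \in r -> ~ spectrum T z.
  move=> zr; apply: hp; rewrite pE rootZ ?lead_coef_eq0// root_prod_XsubC//.
rewrite pE.
have [S0 hS0] : exists S, is_inverse (cpoly_op (\prod_(z <- r) ('X - z%:P)) T) S.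
  elim: r hr {pE} => [_|z r IH hr].
    exists idfun; rewrite big_nil; split; first exact: bop_id.
    by split=> x /=; rewrite cpoly_opC scale1r.
  have [|S hS] := IH; first by move=> w wr; apply: hr; rewrite inE wr orbT.
  have /contrapT[S' hS'] := hr z (mem_head _ _).
  exists (S \o S'); rewrite big_cons.
  have -> : cpoly_op (('X - z%:P) * \prod_(j <- r) ('X - j%:P)) T =
      (T - z *: (idfun : H -> H)) \o cpoly_op (\prod_(j <- r) ('X - j%:P)) T.
    by apply/funext => x /=; rewrite cpoly_opM ?cpoly_opXsubC//; exact: bop_lin.
  exact: is_inverse_comp.
have c0 : lead_coef p != 0 by rewrite lead_coef_eq0.
case: hS0 => Sb [S1 S2].
exists ((lead_coef p)^-1 *: S0); split; first exact: bopZ.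
have Sl := bop_lin Sb.
have Pl := bop_lin (cpoly_op_bop (\prod_(z <- r) ('X - z%:P)) Tb).
split=> x; rewrite scalrfctE cpoly_opZ.
  by rewrite linZ// S1 scalerA mulVf// scale1r.
by rewrite linZ// S2 scalerA mulfV// scale1r.
Qed.

End PolyOp.

(** * Positivity and norm of polynomials in a self-adjoint operator *)

Section Positivity.
Context {R : realType} {H : completeNormedModType R[i]}.
Variable dot : {dot H for Num.conj}.
Hypothesis dotH : induces_norm dot.
Implicit Types (x y z : H) (a b c d : R) (S T U : H -> H) (p q : {poly R}).
Local Notation ip := (ip dot).
Local Notation sadj := (sadj dot).

Lemma psd_CauchySchwarz T x y : linear T -> sadj T -> (forall x, 0 <= ip (T x) x) ->
  ip (T x) y ^+ 2 <= ip (T x) x * ip (T y) y.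
Proof.
move=> Tl Ts T0; apply: quadratic_ge0_discriminant; first exact: T0.
move=> s; have := T0 (x + s%:C *: y).
rewrite linD// linZ// !ipE (ipC _ (T y) x) -Ts; lra.
Qed.

(** This is [T^2 <= k T]. Cauchy-Schwarz for the form of [T] at [x] and [T x] gives
    [|T x|^4 <= <T x, x> k |T x|^2], and a factor [|T x|^2] cancels. *)
Lemma psd_norm T k : linear T -> sadj T -> (forall x, 0 <= ip (T x) x) ->
  (forall x, nr (T x) <= k * nr x) ->
  forall x, ip (T x) (T x) <= k * ip (T x) x.
Proof.
move=> Tl Ts T0 hk x; have [z|nz] := eqVneq (ip (T x) (T x)) 0.
  have -> : ip (T x) x = 0 by rewrite (ip_eq0 dotH z) ip0l.
  by rewrite z mulr0.
have p0 : 0 < ip (T x) (T x) by rewrite lt_neqAle eq_sym nz ip_ge0.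
have := psd_CauchySchwarz x (T x) Tl Ts T0; rewrite expr2 => h.
have h2 := form_le_norm dotH hk (T x).
rewrite -(ler_pM2r p0) (le_trans h)// (mulrC k) -mulrA.
exact: ler_wpM2l (T0 x) _ _ h2.
Qed.

(** If [l] bounds the inverse and [k] bounds [T], then [|x|^2 <= l^2 |T x|^2 <= l^2 k <T x, x>]. *)
Lemma psd_inverse_coercive T : bounded_op T -> sadj T -> (forall x, 0 <= ip (T x) x) ->
  (exists S, is_inverse T S) ->
  exists2 d, 0 < d & forall x, d * ip x x <= ip (T x) x.
Proof.
move=> /bopP[Tl [k k0 hk]] Ts T0 [S [/bopP[_ [l l0 hl]] [ST TS]]].
exists (l ^+ 2 * k)^-1; first by rewrite invr_gt0 mulr_gt0// exprn_gt0.
move=> x; rewrite ler_pdivrMl ?mulr_gt0 ?exprn_gt0// -mulrA.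
have := hl (T x); rewrite ST => /(ip_le_of_nr_le dotH (ltW l0)) /le_trans; apply.
by rewrite ler_pM2l ?exprn_gt0// (psd_norm Tl).
Qed.

Lemma poly_opD p q T : poly_op (p + q) T = poly_op p T + poly_op q T.
Proof. by apply/funext => x; rewrite addrfctE !poly_opE rmorphD cpoly_opD. Qed.

Lemma poly_opM p q T : linear T -> poly_op (p * q) T = poly_op p T \o poly_op q T.
Proof. by move=> Tl; apply/funext => x /=; rewrite !poly_opE rmorphM cpoly_opM. Qed.

Lemma poly_opC c T : poly_op c%:P T = c%:C *: (idfun : H -> H).
Proof. by apply/funext => x; rewrite poly_opE map_polyC cpoly_opC. Qed.

Lemma poly_opX T : poly_op 'X T = T.
Proof.
apply/funext => x; rewrite poly_opE map_polyX -['X]mul1r cpoly_opMX.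
by rewrite -[1]/(1%:P) cpoly_opC scale1r.
Qed.

Lemma poly_op_bop p T : bounded_op T -> bounded_op (poly_op p T).
Proof. by move=> Tb; rewrite poly_opE; exact: cpoly_op_bop. Qed.

Lemma poly_op_sadj p T : linear T -> sadj T -> sadj (poly_op p T).
Proof.
move=> Tl Ts; elim/poly_ind: p => [|p c IH] x y.
  by rewrite !poly_opE rmorph0 !cpoly_op0 ip0l ip0r.
rewrite poly_opD poly_opC poly_opM// poly_opX !addrfctE !scalrfctE /= !ipE IH Ts.
by rewrite !poly_opE cpoly_op_comm.
Qed.

Lemma poly_op_psd_nonconstant p T : bounded_op T -> sadj T -> (1 < size p)%N ->
  (forall r, spectrum T r%:C -> 0 <= p.[r]) ->
  forall x, 0 <= ip (poly_op p T x) x.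
Proof.
move=> Tb Ts sp hp x0; rewrite leNgt; apply/negP => x0lt.
have Tl := bop_lin Tb; have Pb := poly_op_bop p Tb; have Ps := poly_op_sadj p Tl Ts.
have /bopP[Pl [k k0 hk]] := Pb.
(* The lower bounds of the form. The supremum is shown to be attained and negative, then to be
   exceeded by [sup E + d]. *)
pose E := [set c | forall x, c * ip x x <= ip (poly_op p T x) x].
have ub0 : ubound E 0.
  move=> c hc; rewrite leNgt; apply/negP => c0; have := hc x0.
  have := ip_ge0 dotH x0; have : 0 <= c * ip x0 x0 by rewrite mulr_ge0 ?ip_ge0// ltW.
  by move: x0lt; lra.
have Ek : E (- k).
  move=> x; have := form_le_norm dotH (T := - poly_op p T) (k := k).
  move=> /(_ _ x); rewrite opprfctE !ipE => h.
  suff: - ip (poly_op p T x) x <= k * ip x x by lra.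
  by apply: h => y; rewrite nrN.
have sE : has_sup E by split; [exists (- k)|exists 0].
have Es : E (sup E).
  move=> x; apply/ler_addgt0Pl => e e0.
  have e'0 : 0 < e / (ip x x + 1) by rewrite divr_gt0// ltr_wpDl// ip_ge0.
  have [c Ec hc] := sup_adherent e'0 sE.
  have h := Ec x; have x20 := ip_ge0 dotH x.
  have : (sup E - e / (ip x x + 1)) * ip x x <= c * ip x x by rewrite ler_wpM2r// ltW.
  suff : e / (ip x x + 1) * ip x x <= e by lra.
  rewrite -mulrA ler_piMr ?(ltW e0)// mulrC ler_pdivrMr ?mul1r; lra.
have s0 : sup E < 0.
  rewrite ltNge; apply/negP => s0; have := Es x0.
  have : 0 <= sup E * ip x0 x0 by rewrite mulr_ge0 ?ip_ge0.
  by move: x0lt; lra.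
pose q := p - (sup E)%:P.
(* Here [1 < size p] enters: [p] cannot equal a constant. *)
have q0 : q != 0.
  apply/eqP => /eqP; rewrite subr_eq0 => /eqP pE; move: sp.
  by rewrite pE ltnNge size_polyC_leq1.
have qE : poly_op q T = poly_op p T - (sup E)%:C *: (idfun : H -> H).
  by rewrite /q -polyCN poly_opD poly_opC rmorphN scaleNr.
have Qi : exists S, is_inverse (poly_op q T) S.
  rewrite poly_opE; apply: cpoly_op_inverse => //; first by rewrite map_poly_eq0.
  move=> z rz sz; have := spectrum_real dotH Tb Ts sz.
  case: z rz sz => u v /= + + v0; rewrite v0 => rz sz.
  move: rz; rewrite /root -[u +i* 0]/(u%:C) horner_map fmorph_eq0 /q hornerD hornerN hornerC.
  by move=> /eqP; have := hp _ sz; lra.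
have [] := psd_inverse_coercive (poly_op_bop q Tb) (poly_op_sadj q Tl Ts) _ Qi.
  by move=> x; rewrite qE shiftE !ipE; have := Es x; lra.
move=> d d0 hd; have : E (sup E + d).
  by move=> x; have := hd x; rewrite qE shiftE !ipE; lra.
by move=> /(ub_le_sup (ex_intro _ 0 ub0)); lra.
Qed.

Lemma poly_op_psd p T : bounded_op T -> sadj T ->
  (forall r, spectrum T r%:C -> 0 <= p.[r]) ->
  forall x, 0 <= ip (poly_op p T x) x.
Proof.
move=> Tb Ts hp; have [/(poly_op_psd_nonconstant Tb Ts)/(_ hp)//|] := ltnP 1 (size p).
move=> /size1_polyC pE; rewrite pE in hp *.
rewrite poly_opC => x; rewrite scalrfctE ipE.
have [c0|c0] := leP 0 p`_0; first by rewrite mulr_ge0 ?ip_ge0.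
(* A negative constant forces an empty real spectrum. Then [X - (k + 1)] is vacuously nonnegative on
   it, so [(k + 1) |x|^2 <= <T x, x> <= k |x|^2] and [x = 0]. *)
have s0 r : ~ spectrum T r%:C by move=> /hp; rewrite hornerC; lra.
have /bopP[_ [k k0 hk]] := Tb.
have := @poly_op_psd_nonconstant ('X - (k + 1)%:P) T Tb Ts.
rewrite size_XsubC => /(_ isT) h; have {}h := h _ x.
have : 0 <= ip (poly_op ('X - (k + 1)%:P) T x) x by apply: h => r /s0.
rewrite -polyCN poly_opD poly_opX poly_opC addrfctE scalrfctE !ipE => h1.
have h2 := form_le_norm dotH hk x; have h3 := ip_ge0 dotH x.
have -> : ip x x = 0 by lra.
by rewrite mulr0.
Qed.

(** The polynomial [e^2 - p^2] is nonnegative on the spectrum; positivity of its operator is the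
    squared norm bound. *)
Lemma poly_op_norm p T e : bounded_op T -> sadj T -> 0 <= e ->
  (forall r, spectrum T r%:C -> `|p.[r]| <= e) ->
  forall x, nr (poly_op p T x) <= e * nr x.
Proof.
move=> Tb Ts e0 hp x; apply: (nr_le_of_ip_le dotH) => //.
have Tl := bop_lin Tb.
have := @poly_op_psd ((e ^+ 2)%:P - p ^+ 2) T Tb Ts.
have -> : (e ^+ 2)%:P - p ^+ 2 = (e ^+ 2)%:P + (-1)%:P * (p * p).
  by rewrite polyCN mulNr mul1r expr2.
rewrite poly_opD poly_opC !poly_opM// poly_opC => h.
have /h/(_ x) : forall r, spectrum T r%:C -> 0 <= ((e ^+ 2)%:P + (-1)%:P * (p * p)).[r].
  move=> r /hp hr; have : p.[r] ^+ 2 <= e ^+ 2.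
    by rewrite -[p.[r] ^+ 2]real_normK ?num_real// ler_sqr ?nnegrE.
  by rewrite hornerD !hornerM !hornerC; lra.
rewrite addrfctE /= !scalrfctE /= ipDl !ipZl.
by rewrite (poly_op_sadj p Tl Ts); lra.
Qed.

End Positivity.

(** * Bernstein approximation *)

Section Bernstein.
Context {R : realType}.
Implicit Types (f g h : nat -> R) (x c : R).

(* The expectation of [g (N)] for [N] binomial with parameters [n] and ['X],
   by conditioning on the first trial. *)
Fixpoint bernstein n g : {poly R} :=
  if n is n'.+1 then
    'X * bernstein n' (g \o succn) + (1 - 'X) * bernstein n' g
  else (g 0%N)%:P.

Lemma bernstein_le n g h x : 0 <= x <= 1 -> (forall k, (k <= n)%N -> g k <= h k) ->
  (bernstein n g).[x] <= (bernstein n h).[x].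
Proof.
move=> /andP[x0 x1]; elim: n g h => [|n IH] g h gh /=.
  by rewrite !hornerE gh.
rewrite !hornerE; apply: lerD; apply: ler_wpM2l; rewrite ?subr_ge0//; apply: IH => k kn.
  exact: gh.
by apply: gh; rewrite (leq_trans kn).
Qed.

Lemma bernstein_affine n g a b x :
  (bernstein n (fun k => a * g k + b)).[x] = a * (bernstein n g).[x] + b.
Proof.
elim: n g => [|n IH] g /=; first by rewrite !hornerE.
by rewrite !hornerE (IH (g \o succn)) IH; ring.
Qed.

(** The binomial variance. The shift [c] makes the induction close: the first trial changes it by
    [1 - x] or by [- x]. *)
Lemma bernstein_variance n c x :
  (bernstein n (fun k => (k%:R - n%:R * x + c) ^+ 2)).[x] = n%:R * x * (1 - x) + c ^+ 2.
Proof.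
elim: n c => [|n IH] c /=; first by rewrite !hornerE; ring.
rewrite !hornerE.
have -> : (fun k => (k%:R - n.+1%:R * x + c) ^+ 2) \o succn =
    (fun k => (k%:R - n%:R * x + (c + 1 - x)) ^+ 2).
  by apply/funext => k /=; rewrite !mulrS; ring.
have -> : (fun k : nat => (k%:R - n.+1%:R * x + c) ^+ 2) =
    (fun k => (k%:R - n%:R * x + (c - x)) ^+ 2).
  by apply/funext => k /=; rewrite !mulrS; ring.
by rewrite !IH mulrS; ring.
Qed.

(* [|u| <= d + u^2 / d] reduces the Lipschitz bound to the variance. *)
Lemma bernstein_lipschitz (f : R -> R) L x d n : 0 <= L -> 0 < d -> (0 < n)%N ->
  0 <= x <= 1 ->
  (forall y, 0 <= y <= 1 -> `|f y - f x| <= L * `|y - x|) ->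
  `|(bernstein n (fun k => f (k%:R / n%:R))).[x] - f x| <= L * d + L / (d * n%:R).
Proof.
move=> L0 d0 n0 x01 fL; have nR : 0 < n%:R :> R by rewrite ltr0n.
(* With [u = k / n - x], [q * g k] is [L u^2 / d]. *)
pose q := L / (d * n%:R ^+ 2).
pose g k : R := (k%:R - n%:R * x + 0) ^+ 2.
have fg k : (k <= n)%N -> `|f (k%:R / n%:R) - f x| <= q * g k + L * d.
  move=> kn; apply: le_trans (fL _ _) _.
    by rewrite divr_ge0//= ler_pdivrMr// mul1r ler_nat.
  have -> : q * g k + L * d = L * ((k%:R / n%:R - x) ^+ 2 / d + d).
    by rewrite /q /g; field; rewrite ?gt_eqF.
  rewrite ler_wpM2l//; set u := _ - x; rewrite -(ler_pM2r d0) mulrDl divfK ?gt_eqF//.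
  rewrite -[u ^+ 2]real_normK ?num_real//.
  have : 0 <= (`|u| - d) ^+ 2 by rewrite sqr_ge0.
  have : 0 <= `|u| * d by rewrite mulr_ge0// ltW.
  by rewrite sqrrB; lra.
have gx : (bernstein n g).[x] = n%:R * x * (1 - x).
  by rewrite bernstein_variance expr0n /= addr0.
have qn : q * (n%:R * x * (1 - x)) <= L / (d * n%:R).
  have -> : q * (n%:R * x * (1 - x)) = L / (d * n%:R) * (x * (1 - x)).
    by rewrite /q; field; rewrite ?gt_eqF.
  move: x01 => /andP[x0 x1]; rewrite ler_piMr ?divr_ge0 ?mulr_ge0 ?(ltW d0)//.
  by rewrite mulr_ile1// ?subr_ge0// lerBlDr lerDl.
rewrite ler_norml; apply/andP; split.
  have : (bernstein n (fun k => - q * g k + (f x - L * d))).[x] <=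
         (bernstein n (fun k => f (k%:R / n%:R))).[x].
    by apply: bernstein_le => // k /fg; rewrite ler_norml => /andP[]; lra.
  by rewrite bernstein_affine gx; lra.
have : (bernstein n (fun k => f (k%:R / n%:R))).[x] <=
       (bernstein n (fun k => q * g k + (f x + L * d))).[x].
  by apply: bernstein_le => // k /fg; rewrite ler_norml => /andP[]; lra.
by rewrite bernstein_affine gx; lra.
Qed.

Lemma lipschitz_poly01 (f : R -> R) L e : 0 < L -> 0 < e ->
  (forall x y, 0 <= x <= 1 -> 0 <= y <= 1 -> `|f y - f x| <= L * `|y - x|) ->
  exists p : {poly R}, forall x, 0 <= x <= 1 -> `|p.[x] - f x| <= e.
Proof.
move=> L0 e0 fL; pose d := e / (2 * L).
have d0 : 0 < d by rewrite divr_gt0// mulr_gt0.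
(* With these choices each of the two error terms [L d] and [L / (d n)] is at most [e / 2]. *)
pose n := (Num.truncn (2 * L / (d * e))).+1.
exists (bernstein n (fun k => f (k%:R / n%:R))) => x x01.
apply: le_trans (@bernstein_lipschitz f L x d n (ltW L0) d0 _ x01 _) _ => //.
  by move=> y y01; exact: fL.
have -> : L * d = e / 2 by rewrite /d; field; rewrite gt_eqF.
suff : L / (d * n%:R) <= e / 2 by lra.
have nR : 0 < n%:R :> R by rewrite ltr0n.
rewrite (ler_pdivrMr _ _ (mulr_gt0 d0 nR)).
have : 2 * L / (d * e) < n%:R by rewrite truncnS_gt.
rewrite (ltr_pdivrMr _ _ (mulr_gt0 d0 e0)) => h; apply: ltW; lra.
Qed.

Lemma lipschitz_poly (f : R -> R) a b L e : a <= b -> 0 < L -> 0 < e ->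
  (forall x y, a <= x <= b -> a <= y <= b -> `|f y - f x| <= L * `|y - x|) ->
  exists p : {poly R}, forall x, a <= x <= b -> `|p.[x] - f x| <= e.
Proof.
rewrite le_eqVlt => /orP[/eqP <- _ e0 _|ab L0 e0 fL].
  exists (f a)%:P => x; rewrite -eq_le => /eqP ->.
  by rewrite hornerC subrr normr0 ltW.
have ba : 0 < b - a by rewrite subr_gt0.
have [|x y x01 y01|p hp] := @lipschitz_poly01 (fun x => f (a + (b - a) * x)) (L * (b - a)) e _ e0.
- by rewrite mulr_gt0.
- have aux z : 0 <= z <= 1 -> a <= a + (b - a) * z <= b.
    move=> /andP[z0 z1]; have : 0 <= (b - a) * z by rewrite mulr_ge0// ltW.
    have : (b - a) * z <= (b - a) * 1 by rewrite ler_pM2l.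
    by move=> *; apply/andP; split; lra.
  apply: le_trans (fL _ _ (aux _ x01) (aux _ y01)) _.
  rewrite (_ : a + (b - a) * y - (a + (b - a) * x) = (b - a) * (y - x)); last by ring.
  by rewrite normrM (gtr0_norm ba) mulrA.
exists (p \Po ((b - a)^-1 *: ('X - a%:P))) => x /andP[ax xb].
have h01 : 0 <= (b - a)^-1 * (x - a) <= 1.
  rewrite mulrC divr_ge0 ?subr_ge0 ?(ltW ab)//=.
  by rewrite ler_pdivrMr// mul1r lerD2r.
have := hp _ h01.
rewrite horner_comp hornerZ hornerXsubC.
by rewrite (_ : a + (b - a) * ((b - a)^-1 * (x - a)) = x)//; field; rewrite gt_eqF.
Qed.

(** Powers are monotone, increasing or decreasing with the sign of [s]; adding both endpoint values
    covers the two cases at once. *)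
Lemma powR_le_sum a b (s : R) x : 0 < a -> a <= x <= b -> x `^ s <= a `^ s + b `^ s.
Proof.
move=> a0 /andP[ax xb]; have x0 := lt_le_trans a0 ax.
have [s0|s0] := leP 0 s.
  apply: (@le_trans _ _ (b `^ s)); last by rewrite lerDr powR_ge0.
  by apply: ge0_ler_powR; rewrite ?nnegrE ?(ltW x0)// ltW// (lt_le_trans x0).
have [u sE] : exists u, s = - u by exists (- s); rewrite opprK.
rewrite sE oppr_lt0 in s0 *; rewrite !powRN.
apply: (@le_trans _ _ (a `^ u)^-1); last by rewrite lerDl invr_ge0 powR_ge0.
rewrite lef_pV2 ?posrE ?powR_gt0//.
by apply: ge0_ler_powR; rewrite ?nnegrE ?(ltW s0) ?(ltW a0) ?(ltW x0).
Qed.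

(** Mean value theorem, with the derivative [s r^(s - 1)] bounded by the endpoint values. The
    constant uses [|s| + 1] so that it is positive also for [s = 0]. *)
Lemma powR_lipschitz a b (s : R) : 0 < a -> a <= b ->
  exists2 L : R, 0 < L & forall x y, a <= x <= b -> a <= y <= b ->
    `|y `^ s - x `^ s| <= L * `|y - x|.
Proof.
move=> a0 ab; have b0 := lt_le_trans a0 ab.
pose L := (`|s| + 1) * (a `^ (s - 1) + b `^ (s - 1)).
have L0 : 0 < L by apply: mulr_gt0; [rewrite ltr_wpDl|rewrite addr_gt0 ?powR_gt0].
exists L => //.
have main x y : a <= x -> x <= y -> y <= b -> `|y `^ s - x `^ s| <= L * `|y - x|.
  move=> ax xy yb; have x0 := lt_le_trans a0 ax.
  have D (z : R) : 0 < z -> is_derive z 1 (fun z => z `^ s) (s * z `^ (s - 1)).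
    exact: is_derive1_powR.
  have [z||z zin ->] := @MVT_segment R (fun z => z `^ s) (fun z => s * z `^ (s - 1)) x y xy.
  - by rewrite in_itv /= => /andP[xz _]; apply: D; exact: lt_trans xz.
  - apply: derivable_within_continuous => z; rewrite in_itv /= => /andP[xz _].
    by have [] := D z (lt_le_trans x0 xz).
  rewrite normrM ler_wpM2r// /L normrM ler_pM// ?lerDl//.
  rewrite ger0_norm ?powR_ge0// powR_le_sum//.
  by move: zin; rewrite in_itv /= => /andP[xz zy]; rewrite (le_trans ax)//= (le_trans zy).
move=> x y /andP[ax xb] /andP[ay yb]; have [xy|/ltW yx] := leP x y; first exact: main.
by rewrite distrC (distrC y); exact: main.
Qed.

End Bernstein.

(** * Functional calculus *)

Section FunctionalCalculus.
Context {R : realType} {H : completeNormedModType R[i]}.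
Variable dot : {dot H for Num.conj}.
Hypothesis dotH : induces_norm dot.
Implicit Types (x y z : H) (a b c d e : R) (S T U : H -> H) (p q : {poly R}).
Local Notation ip := (ip dot).
Local Notation sadj := (sadj dot).

Lemma natV_small e : 0 < e -> exists N, forall n, (N <= n)%N -> n.+1%:R^-1 <= e.
Proof.
move=> e0; exists (Num.truncn e^-1) => n Nn.
rewrite -[e]invrK lef_pV2 ?posrE ?invr_gt0 ?ltr0n//.
by rewrite (le_trans (ltW (truncnS_gt _)))// ler_nat ltnS.
Qed.

(** One polynomial for each precision replaces the sequence; precisions [1 / (n + 1)] recover it by
    choice. *)
Lemma is_fun_calcP (f : R -> R) T S : is_fun_calc f T S <->
  bounded_op S /\ forall e, 0 < e -> exists p,
    (forall r, spectrum T r%:C -> `|p.[r] - f r| <= e) /\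
    (forall x, nr (poly_op p T x - S x) <= e * nr x).
Proof.
split=> [[Sb [p [h1 h2]]]|[Sb h]]; split=> //.
  move=> e e0; have [N1 _ H1] := h1 _ e0; have [N2 _ H2] := h2 _ e0.
  exists (p (maxn N1 N2)); split=> [r sr|x].
    by apply: H1 sr; exact: leq_maxl.
  by have /= := H2 _ (leq_maxr N1 N2) x; rewrite !nrE -rmorphM lecR.
have /choice[p hp] n := h n.+1%:R^-1 (eqbRL (invr_gt0 _) (ltr0Sn _ n)).
exists p; split=> e e0; have [N hN] := natV_small e0; exists N => // n /= Nn.
  by move=> r sr; rewrite (le_trans ((hp n).1 r sr))// hN.
move=> x; rewrite !nrE -rmorphM lecR (le_trans ((hp n).2 x))//.
by rewrite ler_wpM2r ?nr_ge0// hN.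
Qed.

Lemma form_close S S' e x : (forall x, nr (S x - S' x) <= e * nr x) ->
  ip (S x) x <= ip (S' x) x + e * ip x x.
Proof.
move=> h; have := le_trans (ip_le_nrM dotH (S x - S' x) x) (ler_wpM2r (nr_ge0 x) (h x)).
by rewrite ipBl ipxx//; lra.
Qed.

Lemma fun_calc_bop f T S : is_fun_calc f T S -> bounded_op S.
Proof. by case. Qed.

(** If [p] and [q] approximate [f] and [g] within [d], then [q + 2 d - p] is nonnegative on the
    spectrum. The total error in the forms is [4 d |x|^2], which the choice of [d] keeps below
    [e]. *)
Lemma fun_calc_le f g T S S' : bounded_op T -> sadj T ->
  is_fun_calc f T S -> is_fun_calc g T S' ->
  (forall r, spectrum T r%:C -> f r <= g r) -> forall x, ip (S x) x <= ip (S' x) x.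
Proof.
move=> Tb Ts /is_fun_calcP[Sb hS] /is_fun_calcP[Sb' hS'] fg x.
apply/ler_addgt0Pr => e e0.
have x0 := ip_ge0 dotH x.
have d0 : 0 < e / (4 * (ip x x + 1)) by rewrite divr_gt0// mulr_gt0// ltr_wpDl.
move: d0; set d := e / _ => d0.
have [p [p1 p2]] := hS _ d0; have [q [q1 q2]] := hS' _ d0.
have h1 : ip (S x) x <= ip (poly_op p T x) x + d * ip x x.
  by apply: form_close => y; rewrite nrB.
have h2 := form_close x q2.
have h3 : 0 <= ip (poly_op (q + (2 * d)%:P + (-1)%:P * p) T x) x.
  apply: (poly_op_psd dotH) => // r sr.
  have := p1 _ sr; have := q1 _ sr; rewrite !ler_norml => /andP[? ?] /andP[? ?].
  by have := fg _ sr; rewrite !hornerD hornerM !hornerC; lra.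
have {}h3 : 0 <= ip (poly_op q T x) x + 2 * d * ip x x - ip (poly_op p T x) x.
  move: h3; rewrite !poly_opD poly_opM; last exact: bop_lin.
  by rewrite !poly_opC !addrfctE /= !scalrfctE /= !ipDl !ipZl; lra.
have h4 : 4 * (d * ip x x) <= e.
  rewrite /d; have -> : 4 * (e / (4 * (ip x x + 1)) * ip x x) = e * (ip x x / (ip x x + 1)).
    by field; lra.
  by rewrite ler_piMr ?(ltW e0)// ler_pdivrMr; lra.
lra.
Qed.

Lemma fun_calc_sadj f T S : bounded_op T -> sadj T -> is_fun_calc f T S -> sadj S.
Proof.
move=> Tb Ts /is_fun_calcP[Sb hS].
(* One inequality is enough, since exchanging [x] and [y] gives the other. *)
have main x y : ip (S x) y <= ip x (S y).
  apply/ler_addgt0Pr => e e0.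
  have xy0 : 0 <= nr x * nr y by rewrite mulr_ge0 ?nr_ge0.
  have d0 : 0 < e / (2 * (nr x * nr y + 1)) by rewrite divr_gt0// mulr_gt0// ltr_wpDl.
  move: d0; set d := e / _ => d0.
  have [p [_ p2]] := hS _ d0.
  have h1 : ip (S x - poly_op p T x) y <= d * nr x * nr y.
    apply: le_trans (ip_le_nrM dotH _ _) _; rewrite ler_wpM2r ?nr_ge0//.
    by rewrite nrB.
  have h2 : ip x (poly_op p T y - S y) <= nr x * (d * nr y).
    by apply: le_trans (ip_le_nrM dotH _ _) _; rewrite ler_wpM2l ?nr_ge0.
  move: h1 h2; rewrite ipBl ipBr (poly_op_sadj p (bop_lin Tb) Ts) => h1 h2.
  have h4 : 2 * (d * (nr x * nr y)) <= e.
    rewrite /d.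
    have -> : 2 * (e / (2 * (nr x * nr y + 1)) * (nr x * nr y)) =
        e * (nr x * nr y / (nr x * nr y + 1)) by field; lra.
    by rewrite ler_piMr ?(ltW e0)// ler_pdivrMr; lra.
  lra.
by move=> x y; apply: le_anti; rewrite main/= (ipC _ x) (ipC _ _ y) main.
Qed.

(** By comparison in both directions, [S - S'] has zero form; Cauchy-Schwarz for that form at [x]
    and [(S - S') x] then gives [(S - S') x = 0]. *)
Lemma fun_calc_eq f g T S S' : bounded_op T -> sadj T ->
  is_fun_calc f T S -> is_fun_calc g T S' ->
  (forall r, spectrum T r%:C -> f r = g r) -> S = S'.
Proof.
move=> Tb Ts fS gS fg; apply/funext => x.
have Sl := bop_lin fS.1; have Sl' := bop_lin gS.1.
have D0 y : ip (S y) y = ip (S' y) y.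
  by apply: le_anti; rewrite (fun_calc_le Tb Ts fS gS) ?(fun_calc_le Tb Ts gS fS)// => r /fg ->.
have Dl : linear (S - S') by apply: bop_lin; apply: bopB; [case: fS|case: gS].
have Ds : sadj (S - S').
  by move=> u v; rewrite !addrfctE !opprfctE !ipE (fun_calc_sadj Tb Ts fS) (fun_calc_sadj Tb Ts gS).
have D00 y : ip ((S - S') y) y = 0 by rewrite addrfctE opprfctE ipBl D0 subrr.
have := psd_CauchySchwarz x (S x - S' x) Dl Ds; rewrite !D00 mulr0 => h.
have {}h : ip (S x - S' x) (S x - S' x) ^+ 2 <= 0 by apply: h => y; rewrite D00.
have := sqr_ge0 (ip (S x - S' x) (S x - S' x)) => h'.
have /eqP : ip (S x - S' x) (S x - S' x) ^+ 2 = 0 by apply: le_anti; rewrite h h'.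
by rewrite sqrf_eq0 => /eqP /(ip_eq0 dotH)/eqP; rewrite subr_eq0 => /eqP.
Qed.

Lemma fun_calc_poly p T : bounded_op T -> is_fun_calc (horner p) T (poly_op p T).
Proof.
move=> Tb; apply/is_fun_calcP; split; first exact: poly_op_bop.
move=> e e0; exists p; split=> *; rewrite subrr.
  by rewrite normr0 ltW.
by rewrite nr0 mulr_ge0 ?nr_ge0 ?ltW.
Qed.

Lemma fun_calc_mul f g T S S' C : bounded_op T ->
  is_fun_calc f T S -> is_fun_calc g T S' ->
  (forall r, spectrum T r%:C -> `|f r| <= C) ->
  (forall r, spectrum T r%:C -> `|g r| <= C) ->
  is_fun_calc (fun r => f r * g r) T (S \o S').
Proof.
move=> Tb /is_fun_calcP[Sb hS] /is_fun_calcP[Sb' hS'] fC gC.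
apply/is_fun_calcP; split; first exact: bop_comp.
have /bopP[Sl [k k0 hk]] := Sb; have /bopP[Sl' [k' k'0 hk']] := Sb'.
move=> e e0; pose K := `|C| + k + k'.
have K0 : 0 < K by rewrite /K -addrA ltr_wpDl// addr_gt0.
have CK : C <= K by rewrite /K; have := ler_norm C; lra.
have kK : k <= K by rewrite /K; have := normr_ge0 C; lra.
have k'K : k' <= K by rewrite /K; have := normr_ge0 C; lra.
move: K K0 CK kK k'K => K K0 CK kK k'K.
have eK0 : 0 < e + 2 * K + 1 by lra.
(* [K] bounds both functions on the spectrum and both operators. As [d <= 1], the product error
   [(K + d) d + d K] is at most [d (2 K + 1) <= e]. *)
pose d := e / (e + 2 * K + 1).
have d0 : 0 < d by rewrite divr_gt0.
have d1 : d <= 1 by rewrite ler_pdivrMr// mul1r; lra.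
have de : (K + d) * d + d * K <= e.
  have h1 : d * (e + 2 * K + 1) = e by rewrite /d divfK// gt_eqF.
  have h2 : d * d <= d by rewrite ler_piMl// ltW.
  have h3 : 0 < d * e by rewrite mulr_gt0.
  lra.
have [p [p1 p2]] := hS _ d0; have [q [q1 q2]] := hS' _ d0.
exists (p * q); split=> [r sr|x].
  rewrite hornerM.
  have -> : p.[r] * q.[r] - f r * g r =
     (f r + (p.[r] - f r)) * (q.[r] - g r) + (p.[r] - f r) * g r by ring.
  apply: le_trans (ler_normD _ _) (le_trans _ de).
  rewrite !normrM lerD// ler_pM//; [|exact: q1|exact: p1|].
    by rewrite (le_trans (ler_normD _ _))// lerD// ?p1// (le_trans (fC _ sr)).
  by rewrite (le_trans (gC _ sr)).
rewrite poly_opM /=; last exact: bop_lin.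
have Pl := bop_lin (poly_op_bop p Tb).
have -> : poly_op p T (poly_op q T x) - S (S' x) =
   (S (poly_op q T x - S' x) + (poly_op p T (poly_op q T x - S' x) - S (poly_op q T x - S' x)))
   + (poly_op p T (S' x) - S (S' x)).
  by rewrite [S _ + _]addrC subrK (linB Pl) subrKA.
apply: le_trans (nrD _ _) (le_trans _ (ler_wpM2r (nr_ge0 x) de)).
rewrite mulrDl lerD//; last first.
  rewrite (le_trans (p2 _))// -(mulrA d K) ler_wpM2l ?(ltW d0)//.
  by rewrite (le_trans (hk' x))// ler_wpM2r ?nr_ge0.
rewrite (le_trans (nrD _ _))//; have h := q2 x.
rewrite -mulrA (@le_trans _ _ ((K + d) * nr (poly_op q T x - S' x)))//; last first.
  by rewrite ler_wpM2l// addr_ge0 ?ltW.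
rewrite mulrDl lerD//.
by rewrite (le_trans (hk _))// ler_wpM2r ?nr_ge0.
Qed.

(** Pointwise limits exist by completeness; the Cauchy estimate is uniform relative to [nr x] and
    passes to the limit, which yields linearity and boundedness. *)
Lemma op_cauchy_cvg (P : nat -> H -> H) : (forall n, bounded_op (P n)) ->
  (forall e, 0 < e -> exists N, forall m n, (N <= m)%N -> (N <= n)%N ->
     forall x, nr (P m x - P n x) <= e * nr x) ->
  exists2 S, bounded_op S & forall e, 0 < e -> exists N, forall n, (N <= n)%N ->
     forall x, nr (P n x - S x) <= e * nr x.
Proof.
move=> Pb hP.
have /choice[S hS] x : exists l, forall e : R, 0 < e -> exists N, forall n, (N <= n)%N ->
     nr (P n x - l) <= e.
  apply: nr_cauchy => e e0.
  have x0 := nr_ge0 x.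
  have x1 : 0 < nr x + 1 by rewrite ltr_wpDl.
  have [N hN] := hP (e / (nr x + 1)) (divr_gt0 e0 x1).
  exists N => m n Nm Nn; rewrite (le_trans (hN m n Nm Nn x))// mulrAC ler_pdivrMr//.
  by rewrite ler_pM2l// lerDl.
have unif e : 0 < e -> exists N, forall n, (N <= n)%N ->
     forall x, nr (P n x - S x) <= e * nr x.
  move=> e0; have [N hN] := hP e e0; exists N => n Nn x.
  apply/ler_addgt0Pr => d d0; have [M hM] := hS x d d0.
  rewrite -(subrKA (P (maxn N M) x)) (le_trans (nrD _ _))// lerD//.
    by rewrite hN// leq_maxl.
  by rewrite hM// leq_maxr.
exists S => //; have [N hN] := unif 1 ltr01.
apply/bopP; split.
  move=> a u v; apply/eqP; rewrite -subr_eq0; apply/eqP/nr0_eq0/le_anti.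
  rewrite nr_ge0 andbT; apply/ler_addgt0Pr => e e0; rewrite add0r.
  pose w := nr (a *: u + v) + complex.Re `|a| * nr u + nr v + 1.
  have w0 : 0 < w by rewrite ltr_wpDl// !addr_ge0 ?nr_ge0// mulr_ge0 ?nr_ge0// complex_Re_norm_ge0.
  have [M hM] := unif (e / w) (divr_gt0 e0 w0); have {}hM := hM M (leqnn M).
  have Pl := bop_lin (Pb M).
  have -> : S (a *: u + v) - (a *: S u + S v) =
    - (P M (a *: u + v) - S (a *: u + v)) + (a *: (P M u - S u) + (P M v - S v)).
    by rewrite Pl scalerBr opprB (addrACA (a *: P M u)) -opprD addrA subrK.
  apply: le_trans (nrD _ _) _; rewrite nrN.
  apply: le_trans (lerD (hM _) (nrD _ _)) _; rewrite nrZ.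
  have h1 := hM v; have h2 : complex.Re `|a| * nr (P M u - S u) <= complex.Re `|a| * (e / w * nr u).
    by rewrite ler_wpM2l// complex_Re_norm_ge0.
  have h3 : e = e / w * (nr (a *: u + v) + complex.Re `|a| * nr u + nr v + 1).
    by rewrite divfK// gt_eqF.
  rewrite [leRHS]h3; have := divr_gt0 e0 w0.
  by move: h1 h2; move: (e / w) => t; lra.
have /bopP[_ [k k0 hk]] := Pb N; exists (k + 1); first by rewrite addr_gt0.
move=> x; rewrite -[S x](subKr (P N x)) (le_trans (nrD _ _))// nrN mulrDl.
by rewrite lerD// hN.
Qed.

(** By [poly_op_norm], polynomials that are uniformly Cauchy on the spectrum give operators that are
    Cauchy in norm. *)
Lemma fun_calc_exists (f : R -> R) T : bounded_op T -> sadj T ->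
  (forall e, 0 < e -> exists p, forall r, spectrum T r%:C -> `|p.[r] - f r| <= e) ->
  exists S, is_fun_calc f T S.
Proof.
move=> Tb Ts hf.
have /choice[p hp] n := hf n.+1%:R^-1 (eqbRL (invr_gt0 _) (ltr0Sn _ n)).
have [||S Sb hS] := @op_cauchy_cvg (fun n => poly_op (p n) T).
- by move=> n; exact: poly_op_bop.
- move=> e e0; have [N hN] := natV_small (divr_gt0 e0 (ltr0Sn _ 1)).
  exists N => m n Nm Nn x.
  have -> : poly_op (p m) T x - poly_op (p n) T x = poly_op (p m + (-1)%:P * p n) T x.
    rewrite poly_opD poly_opM; last exact: bop_lin.
    by rewrite poly_opC addrfctE /= scalrfctE rmorphN scaleN1r.
  apply: (poly_op_norm dotH) => //; first exact: ltW.
  move=> r sr; rewrite hornerD hornerM hornerC mulN1r.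
  rewrite -(subrKA (f r)) (le_trans (ler_normD _ _))//.
  rewrite (distrC (f r)); apply: le_trans (lerD (hp m _ sr) (hp n _ sr)) _.
  by apply: le_trans (lerD (hN _ Nm) (hN _ Nn)) _; lra.
exists S; apply/is_fun_calcP; split=> // e e0.
have [N1 h1] := hS e e0; have [N2 h2] := natV_small e0.
exists (p (maxn N1 N2)); split; last by apply: h1; exact: leq_maxl.
by move=> r sr; rewrite (le_trans (hp _ _ sr))// h2// leq_maxr.
Qed.

End FunctionalCalculus.

(** * Power inequalities *)

Section PowerInequalities.
Context {R : realType}.
Implicit Types (a b s t u x y : R).

Lemma ln_le_subr1 x : 0 < x -> ln x <= x - 1.
Proof.
move=> x0; rewrite -[leRHS]expRK ler_ln ?posrE ?expR_gt0//.
by have := expR_ge1Dx (x - 1); lra.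
Qed.

(** Let [w] be the arithmetic mean. The bound [ln z <= z - 1] at [x / w] and [y / w], summed with
    weights [t] and [1 - t], has right-hand side 0. *)
Lemma powR_amgm t x y : 0 <= t <= 1 -> 0 < x -> 0 < y ->
  x `^ t * y `^ (1 - t) <= t * x + (1 - t) * y.
Proof.
move=> /andP[t0 t1] x0 y0.
have w0 : 0 < t * x + (1 - t) * y.
  have [->|tn0] := eqVneq t 0; first by lra.
  by rewrite ltr_wpDr ?mulr_ge0 ?subr_ge0 ?(ltW y0)// mulr_gt0// lt_neqAle eq_sym tn0.
set w := _ + _ in w0 *.
rewrite /powR !gt_eqF//= -expRD -[leRHS](lnK w0) ler_expR.
have hx := ln_le_subr1 (divr_gt0 x0 w0); have hy := ln_le_subr1 (divr_gt0 y0 w0).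
rewrite ln_div ?posrE// in hx; rewrite ln_div ?posrE// in hy.
have h1 : t * (ln x - ln w) <= t * (x / w - 1) by rewrite ler_wpM2l.
have h2 : (1 - t) * (ln y - ln w) <= (1 - t) * (y / w - 1) by rewrite ler_wpM2l// subr_ge0.
have h3 : t * (x / w - 1) + (1 - t) * (y / w - 1) = 0.
  have -> : t * (x / w - 1) + (1 - t) * (y / w - 1) = w / w - 1.
    by rewrite {3}/w; field; rewrite gt_eqF.
  by rewrite divff ?gt_eqF// subrr.
lra.
Qed.

Lemma powR_split t x : 0 < x -> x `^ (1 - t) * x `^ t = x.
Proof.
by move=> x0; rewrite -powRD ?subrK ?powRr1 ?(ltW x0)// (gt_eqF x0) implybT.
Qed.

Lemma powR_perspective t x y : 0 < x -> 0 < y -> x * (y / x) `^ t = x `^ (1 - t) * y `^ t.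
Proof.
move=> x0 y0; rewrite powRM ?invr_ge0 ?ltW// -(powR_inv1 (ltW x0)) -powRrM mulN1r powRN.
by rewrite -{1}(powR_split t x0) mulrCA mulfK ?gt_eqF ?powR_gt0// mulrC.
Qed.

(** The tangent of [r^t] at [s]: the weighted mean inequality for [x] and [s], multiplied by
    [s^(t - 1)]. *)
Lemma powR_tangent t s x : 0 <= t <= 1 -> 0 < s -> 0 < x ->
  x `^ t <= t * (s `^ t / s) * x + (1 - t) * s `^ t.
Proof.
move=> t01 s0 x0; have := powR_amgm t01 x0 s0.
have h : 0 < s `^ t / s by rewrite divr_gt0 ?powR_gt0.
move=> /(ler_wpM2r (ltW h)).
have -> : x `^ t * s `^ (1 - t) * (s `^ t / s) = x `^ t.
  have -> : x `^ t * s `^ (1 - t) * (s `^ t / s) = x `^ t * (s `^ (1 - t) * s `^ t) / s.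
    by rewrite !mulrA.
  by rewrite powR_split// mulfK// gt_eqF.
move=> /le_trans; apply; rewrite le_eqVlt; apply/orP; left; apply/eqP.
by field; rewrite gt_eqF.
Qed.

(** The tangent at [x], evaluated at [a] and [b] with weights [b - x] and [x - a], averages to
    [x^t]. *)
Lemma powR_chord a b t x : 0 < a -> a < b -> 0 <= t <= 1 -> a <= x <= b ->
  (b `^ t - a `^ t) / (b - a) * x + (b * a `^ t - a * b `^ t) / (b - a) <= x `^ t.
Proof.
move=> a0 ab t01 /andP[ax xb]; have x0 := lt_le_trans a0 ax; have b0 := lt_trans a0 ab.
have ba : 0 < b - a by rewrite subr_gt0.
have ta := powR_tangent t01 x0 a0; have tb := powR_tangent t01 x0 b0.
rewrite mulrAC -mulrDl ler_pdivrMr//.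
have ha : (b - x) * a `^ t <= (b - x) * (t * (x `^ t / x) * a + (1 - t) * x `^ t).
  by rewrite ler_wpM2l// subr_ge0.
have hb : (x - a) * b `^ t <= (x - a) * (t * (x `^ t / x) * b + (1 - t) * x `^ t).
  by rewrite ler_wpM2l// subr_ge0.
have e : (b - x) * (t * (x `^ t / x) * a + (1 - t) * x `^ t) +
         (x - a) * (t * (x `^ t / x) * b + (1 - t) * x `^ t) = x `^ t * (b - a).
  by field; rewrite gt_eqF.
rewrite -e; lra.
Qed.

(** The line [c r + d] is the chord of [r^t]. The weighted mean inequality for [c x / t] and
    [d / (1 - t)] bounds it below by [(d / (1 - t))^(1 - t) (c / t)^t x^t], whose coefficient is the
    Kantorovich constant. In the degenerate cases the constant is 1 and an affine function agrees
    with the power on the interval. *)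
Lemma kantorovich_chord a b t : 0 < a -> a <= b -> 0 <= t <= 1 ->
  0 < kantorovich a b t /\ exists c d,
    (forall x, a <= x <= b -> c * x + d <= x `^ t) /\
    (forall x, a <= x <= b -> kantorovich a b t * x `^ t <= c * x + d).
Proof.
move=> a0 ab t01; rewrite /kantorovich.
have [t0|tn0] /= := eqVneq t 0.
  split=> //; exists 0, 1; rewrite t0.
  by split=> x _; rewrite powRr0 ?mulr1 mul0r add0r.
have [t1|tn1] /= := eqVneq t 1.
  split=> //; exists 1, 0; rewrite t1.
  by split=> x /andP[/(le_trans (ltW a0)) x0 _]; rewrite powRr1// !mul1r addr0.
have [eab|nab] /= := eqVneq a b.
  split=> //; exists 0, (a `^ t).
  by split=> x; rewrite -eab -eq_le => /eqP <-; rewrite ?mul1r mul0r add0r.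
have {nab}ab : a < b by rewrite lt_neqAle nab.
have t0 : 0 < t by rewrite lt_neqAle eq_sym tn0; case/andP: t01.
have t1 : t < 1 by rewrite lt_neqAle tn1; case/andP: t01.
have t1' : 0 < 1 - t by rewrite subr_gt0.
have b0 := lt_trans a0 ab; have ba : 0 < b - a by rewrite subr_gt0.
pose c := (b `^ t - a `^ t) / (b - a); pose d := (b * a `^ t - a * b `^ t) / (b - a).
have lt_pow s : 0 < s -> a `^ s < b `^ s.
  by move=> s0; apply: gt0_ltr_powR; rewrite ?nnegrE ?(ltW a0) ?(ltW b0).
have c0 : 0 < c by rewrite divr_gt0// subr_gt0 lt_pow.
(* The numerator is [a^t b^t (b^(1 - t) - a^(1 - t))]. *)
have d0 : 0 < d.
  rewrite divr_gt0// subr_gt0 -{1}(powR_split t a0) -{2}(powR_split t b0).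
  rewrite mulrAC -mulrA [ltRHS]mulrAC -[ltRHS]mulrA (mulrC (b `^ t)).
  by rewrite ltr_pM2r ?mulr_gt0 ?powR_gt0// lt_pow.
set K := _ * _.
have KE : K = (d / (1 - t)) `^ (1 - t) * (c / t) `^ t.
  have q0 : 0 < d / (1 - t) by rewrite divr_gt0.
  have p0 : 0 < c / t by rewrite divr_gt0.
  rewrite -powR_perspective// /K; move: c0 d0 => c0 d0.
  have D0 : 0 < b * a `^ t - a * b `^ t by move: d0; rewrite pmulr_lgt0 ?invr_gt0.
  have Dn : a * b `^ t - b * a `^ t != 0 by rewrite -opprB oppr_eq0 gt_eqF.
  have tn : t - 1 != 0 by rewrite subr_eq0.
  congr (_ * _ `^ _).
    by rewrite /d; field; rewrite ?(gt_eqF t1') ?(gt_eqF ba) ?tn.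
  by rewrite /c /d; field; rewrite ?(gt_eqF t1') ?(gt_eqF ba) ?(gt_eqF D0) ?tn0 ?Dn ?tn.
have K0 : 0 < K by rewrite KE; apply: mulr_gt0; apply: powR_gt0; exact: divr_gt0.
split=> //; exists c, d; split=> x xab.
  exact: powR_chord.
have x0 : 0 < x by case/andP: xab => /(lt_le_trans a0).
have := powR_amgm t01 (mulr_gt0 (divr_gt0 c0 t0) x0) (divr_gt0 d0 t1').
have -> : t * (c / t * x) + (1 - t) * (d / (1 - t)) = c * x + d.
  by field; rewrite ?(gt_eqF t1') ?tn0.
move=> /(le_trans _); apply; rewrite KE (powRM _ (ltW (divr_gt0 c0 t0)) (ltW x0)).
by rewrite le_eqVlt; apply/orP; left; apply/eqP; ring.
Qed.

(** The weighted mean [u^(1 - t) v^t] is monotone and homogeneous; apply it to [n^2 <= a i] and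
    [g^2 <= b i]. Later [a], [b], [i], [g] are the forms of [A], [B], [A^-1], [G] at [x], and
    [n = |x|^2]. *)
Lemma powR_combine t a b i n g : 0 <= t <= 1 -> 0 < a -> 0 < b -> 0 < i ->
  0 < n -> 0 < g -> n ^+ 2 <= a * i -> g ^+ 2 <= b * i ->
  (n * (g / n) `^ t) ^+ 2 <= i * (a * (b / a) `^ t).
Proof.
move=> /andP[t0 t1] a0 b0 i0 n0 g0 hn hg.
have n20 : 0 < n ^+ 2 by rewrite exprn_gt0.
have g20 : 0 < g ^+ 2 by rewrite exprn_gt0.
have -> : (n * (g / n) `^ t) ^+ 2 = n ^+ 2 * (g ^+ 2 / n ^+ 2) `^ t.
  rewrite exprMn; congr (_ * _); rewrite !expr2 -powRM ?divr_ge0 ?ltW//.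
  by congr (_ `^ _); field; rewrite gt_eqF.
rewrite !powR_perspective//.
apply: (@le_trans _ _ ((a * i) `^ (1 - t) * (b * i) `^ t)).
  by apply: ler_pM; rewrite ?powR_ge0//; apply: ge0_ler_powR;
    rewrite ?nnegrE ?subr_ge0 ?(ltW n20) ?(ltW g20) ?mulr_ge0 ?(ltW a0) ?(ltW b0) ?(ltW i0).
rewrite !powRM ?(ltW a0) ?(ltW b0) ?(ltW i0)// -{3}(powR_split t i0).
by rewrite le_eqVlt; apply/orP; left; apply/eqP; ring.
Qed.

End PowerInequalities.

(** * Powers of positive operators *)

Section OperatorPowers.
Context {R : realType} {H : completeNormedModType R[i]}.
Variable dot : {dot H for Num.conj}.
Hypothesis dotH : induces_norm dot.
Implicit Types (x y z : H) (a b c d s t : R) (S T U : H -> H).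
Local Notation ip := (ip dot).
Local Notation sadj := (sadj dot).

Definition sa_between a b T := [/\ bounded_op T, sadj T &
  forall x, a * ip x x <= ip (T x) x <= b * ip x x].

Lemma sa_between_conj a b a' b' S T : 0 <= a -> 0 <= b ->
  bounded_op S -> sadj S -> sa_between a b T ->
  (forall x, a' * ip x x <= ip (S x) (S x) <= b' * ip x x) ->
  sa_between (a * a') (b * b') (S \o T \o S).
Proof.
move=> a0 b0 Sb Ss [Tb Ts hT] hS; split.
- by apply: bop_comp => //; exact: bop_comp.
- by move=> x y /=; rewrite Ss Ts Ss.
move=> x /=; rewrite Ss; have /andP[h1 h2] := hT (S x); have /andP[h3 h4] := hS x.
apply/andP; split.
  by rewrite (le_trans _ h1)// -mulrA ler_wpM2l.
by rewrite (le_trans h2)// -mulrA ler_wpM2l.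
Qed.

(** Extends [sadj_norm] to [d = 0], the case [a = b] of the Kantorovich inequality, by enlarging [d]
    slightly. *)
Lemma sadj_norm_ge0 T d : linear T -> sadj T -> 0 <= d ->
  (forall x, `|ip (T x) x| <= d * ip x x) -> forall x, nr (T x) <= d * nr x.
Proof.
move=> Tl Ts d0 hT x; apply/ler_addgt0Pr => e e0.
have x1 : 0 < nr x + 1 by rewrite ltr_wpDl ?nr_ge0.
have q0 : 0 < e / (nr x + 1) by rewrite divr_gt0.
have h y : `|ip (T y) y| <= (d + e / (nr x + 1)) * ip y y.
  by rewrite (le_trans (hT y))// ler_wpM2r ?ip_ge0// lerDl ltW.
apply: le_trans (sadj_norm dotH Tl Ts (ltr_wpDl d0 q0) h x) _.
rewrite mulrDl lerD2l mulrAC ler_pdivrMr// ler_pM2l//.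
by rewrite lerDl.
Qed.

(** For [S = T - a], [S^2 <= (b - a) S] reads [T^2 + a b <= (a + b) T]. Squaring the resulting
    scalar inequality and using [4 a b N n <= (N + a b n)^2] gives the claim. *)
Lemma kantorovich_vector a b T x : 0 < a -> a <= b -> sa_between a b T ->
  ip (T x) (T x) * ip x x <= (a + b) ^+ 2 / (4 * a * b) * ip (T x) x ^+ 2.
Proof.
move=> a0 ab [Tb Ts hT]; have b0 := lt_le_trans a0 ab; have Tl := bop_lin Tb.
pose S := T - a%:C *: (idfun : H -> H).
have SE y : S y = T y - a%:C *: y by [].
have Sl : linear S by apply: bop_lin; exact: bop_shift.
have Ss : sadj S by exact: sadj_shift.
have S0 y : 0 <= ip (S y) y.
  by rewrite SE ipBl ipZl; have /andP[] := hT y; lra.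
have Sn : forall y, nr (S y) <= (b - a) * nr y.
  apply: sadj_norm_ge0; rewrite ?subr_ge0// => y; rewrite ger0_norm//.
  by rewrite SE ipBl ipZl; have /andP[] := hT y; lra.
have := psd_norm dotH Sl Ss S0 Sn x.
rewrite SE !(ipBl, ipBr, ipZl, ipZr) (ipC _ x (T x)).
set N := ip (T x) (T x); set I := ip (T x) x; set n := ip x x => h.
have N0 : 0 <= N by exact: ip_ge0.
have n0 : 0 <= n by exact: ip_ge0.
have ab0 : 0 < a * b by rewrite mulr_gt0.
have h1 : N + a * b * n <= (a + b) * I by lra.
have h2 : (N + a * b * n) ^+ 2 <= ((a + b) * I) ^+ 2.
  have z0 : 0 <= N + a * b * n by rewrite addr_ge0// mulr_ge0// ltW.
  by rewrite ler_sqr ?nnegrE// (le_trans z0).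
have h3 := sqr_ge0 (N - a * b * n).
rewrite mulrAC ler_pdivlMr; last by rewrite -mulrA mulr_gt0.
rewrite exprMn in h2; apply: le_trans h2; lra.
Qed.

(* Cauchy-Schwarz for the form of [T] at [x] and [T^-1 x]. *)
Lemma psd_lower_bound T S c : 0 < c -> linear T -> sadj T ->
  (forall x, 0 <= ip (T x) x) -> is_inverse T S ->
  (forall x, c * nr x <= nr (T x)) -> forall x, c * ip x x <= ip (T x) x.
Proof.
move=> c0 Tl Ts T0 [_ [_ TS]] hc x.
have := psd_CauchySchwarz x (S x) Tl Ts T0; rewrite Ts !TS => h.
have h1 : ip x (S x) <= c^-1 * ip x x.
  rewrite (le_trans (ip_le_nrM dotH _ _))// ipxx// mulrC ler_pdivlMl// expr2.
  by rewrite mulrA ler_wpM2r ?nr_ge0//; have := hc (S x); rewrite TS.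
have [z|nz] := eqVneq (ip x x) 0; first by rewrite z mulr0.
have x0 : 0 < ip x x by rewrite lt_neqAle eq_sym nz ip_ge0.
have h2 : ip x x ^+ 2 <= ip (T x) x * (c^-1 * ip x x).
  by rewrite (le_trans h)// ler_wpM2l.
rewrite -(ler_pM2r x0) -mulrA -expr2 mulrC -ler_pdivlMr//.
by rewrite (le_trans h2)// mulrA mulrAC.
Qed.

(** * Laws and bounds for powers of one positive operator *)

Section Powers.
Variables (a b : R) (T : H -> H).
Hypotheses (a0 : 0 < a) (ab : a <= b) (Tab : sa_between a b T).

Lemma sa_between_spectrum r : spectrum T r%:C -> a <= r <= b.
Proof. by case: Tab => Tb Ts hT; apply: (spectrum_itv dotH Tb Ts hT). Qed.

Lemma op_pow_fun_calc s : is_fun_calc (fun r => r `^ s) T (op_pow T s).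
Proof.
(* The default value 0 is ruled out by constructing the power from polynomial approximations on
   [[a, b]]. *)
case: Tab => Tb Ts hT; rewrite /op_pow /fun_calc; case: xgetP => [S -> //|].
have [L L0 hL] := powR_lipschitz s a0 ab.
have [|S hS /(_ S)] := @fun_calc_exists _ _ dot dotH (fun r => r `^ s) T Tb Ts; last by [].
move=> e e0; have [p hp] := lipschitz_poly ab L0 e0 hL.
by exists p => r /sa_between_spectrum; exact: hp.
Qed.

Lemma op_pow_bop s : bounded_op (op_pow T s).
Proof. exact: fun_calc_bop (op_pow_fun_calc s). Qed.

Lemma op_pow_sadj s : sadj (op_pow T s).
Proof. by case: Tab => Tb Ts _; apply: (fun_calc_sadj dotH Tb Ts (op_pow_fun_calc s)). Qed.

Lemma op_powD s t x : op_pow T s (op_pow T t x) = op_pow T (s + t) x.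
Proof.
case: Tab => Tb Ts _.
pose C := Num.max (a `^ s + b `^ s) (a `^ t + b `^ t).
have hs r : spectrum T r%:C -> `|r `^ s| <= C.
  move=> /sa_between_spectrum h; rewrite ger0_norm ?powR_ge0// le_max.
  by rewrite powR_le_sum.
have ht r : spectrum T r%:C -> `|r `^ t| <= C.
  move=> /sa_between_spectrum h; rewrite ger0_norm ?powR_ge0// le_max.
  by rewrite (powR_le_sum _ a0 h) orbT.
have h := fun_calc_mul Tb (op_pow_fun_calc s) (op_pow_fun_calc t) hs ht.
have := fun_calc_eq dotH Tb Ts h (op_pow_fun_calc (s + t)).
move=> /(_ _)/(congr1 (@^~ x)); apply=> r /sa_between_spectrum /andP[ar _].
by rewrite powRD// (gt_eqF (lt_le_trans a0 ar)) implybT.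
Qed.

Lemma op_pow_affine_le s c d : (forall r, a <= r <= b -> r `^ s <= c * r + d) ->
  forall x, ip (op_pow T s x) x <= c * ip (T x) x + d * ip x x.
Proof.
case: Tab => Tb Ts _ h x.
have := fun_calc_le dotH Tb Ts (op_pow_fun_calc s) (fun_calc_poly (c *: 'X + d%:P) Tb) _ x.
rewrite -mul_polyC poly_opD poly_opM ?poly_opX ?poly_opC; last exact: bop_lin.
rewrite addrfctE /= !scalrfctE /= ipDl !ipZl; apply => r /sa_between_spectrum.
by rewrite hornerD hornerM !hornerC hornerX; exact: h.
Qed.

Lemma op_pow_affine_ge s c d : (forall r, a <= r <= b -> c * r + d <= r `^ s) ->
  forall x, c * ip (T x) x + d * ip x x <= ip (op_pow T s x) x.
Proof.
case: Tab => Tb Ts _ h x.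
have := fun_calc_le dotH Tb Ts (fun_calc_poly (c *: 'X + d%:P) Tb) (op_pow_fun_calc s) _ x.
rewrite -mul_polyC poly_opD poly_opM ?poly_opX ?poly_opC; last exact: bop_lin.
rewrite addrfctE /= !scalrfctE /= ipDl !ipZl; apply => r /sa_between_spectrum.
by rewrite hornerD hornerM !hornerC hornerX; exact: h.
Qed.

Lemma op_pow_between s c d : (forall r, a <= r <= b -> c <= r `^ s <= d) ->
  sa_between c d (op_pow T s).
Proof.
move=> h; split; [exact: op_pow_bop|exact: op_pow_sadj|move=> x].
have h1 r : a <= r <= b -> 0 * r + c <= r `^ s by move=> /h/andP[]; rewrite mul0r add0r.
have h2 r : a <= r <= b -> r `^ s <= 0 * r + d by move=> /h/andP[]; rewrite mul0r add0r.
have := op_pow_affine_ge h1 x; have := op_pow_affine_le h2 x.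
by rewrite mul0r !add0r => -> ->.
Qed.

Lemma op_pow0 x : op_pow T 0 x = x.
Proof.
case: Tab => Tb Ts _.
have := fun_calc_eq dotH Tb Ts (op_pow_fun_calc 0) (fun_calc_poly 1%:P Tb).
move=> -> => [|r _]; first by rewrite poly_opC scalrfctE scale1r.
by rewrite powRr0 hornerC.
Qed.

Lemma op_pow1 x : op_pow T 1 x = T x.
Proof.
case: Tab => Tb Ts _.
have := fun_calc_eq dotH Tb Ts (op_pow_fun_calc 1) (fun_calc_poly 'X Tb).
move=> -> => [|r]; first by rewrite poly_opX.
move=> /sa_between_spectrum/andP[ar _].
by rewrite powRr1 ?hornerX// (le_trans (ltW a0)).
Qed.

Lemma op_powK s x : op_pow T s (op_pow T (- s) x) = x.
Proof. by rewrite op_powD subrr op_pow0. Qed.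

Lemma op_powVK s x : op_pow T (- s) (op_pow T s x) = x.
Proof. by rewrite op_powD addNr op_pow0. Qed.

Lemma op_pow_half x : op_pow T 2^-1 (op_pow T 2^-1 x) = T x.
Proof. by rewrite op_powD -op_pow1; congr (op_pow T _ x); field. Qed.

Lemma op_pow_Nhalf x : op_pow T (- 2^-1) (op_pow T (- 2^-1) x) = op_pow T (- 1) x.
Proof. by rewrite op_powD; congr (op_pow T _ x); field. Qed.

Lemma op_pow_inverse : is_inverse T (op_pow T (- 1)).
Proof.
split; first exact: op_pow_bop.
by split=> x; rewrite -op_pow1 ?op_powVK// op_powK.
Qed.

Lemma op_pow_inv_between : sa_between b^-1 a^-1 (op_pow T (- 1)).
Proof.
apply: op_pow_between => r /andP[ar rb]; have r0 := lt_le_trans a0 ar.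
rewrite powR_inv1 ?(ltW r0)//.
by rewrite !lef_pV2 ?posrE// ?ar ?rb// (lt_le_trans r0).
Qed.

End Powers.
End OperatorPowers.

(** * Geometric means *)

Section SpectralGeometricMean.
Context {R : realType} {H : completeNormedModType R[i]}.
Variable dot : {dot H for Num.conj}.
Hypothesis dotH : induces_norm dot.
Implicit Types (x y z : H) (a b c d s t : R).
Local Notation ip := (ip dot).
Local Notation sadj := (sadj dot).
Variables (A B : H -> H) (m M : R).
Hypotheses (m0 : 0 < m) (mM : m <= M).
Hypotheses (hA : sa_between dot m M A) (hB : sa_between dot m M B).

Let M0 : 0 < M := lt_le_trans m0 mM.

Let Al : linear A. Proof. by case: hA => /bop_lin. Qed.
Let Asa : sadj A. Proof. by case: hA. Qed.
Let A_ge x : m * ip x x <= ip (A x) x. Proof. by case: hA => _ _ /(_ x)/andP[]. Qed.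
Let A_le x : ip (A x) x <= M * ip x x. Proof. by case: hA => _ _ /(_ x)/andP[]. Qed.
Let B_ge x : m * ip x x <= ip (B x) x. Proof. by case: hB => _ _ /(_ x)/andP[]. Qed.
Let B_le x : ip (B x) x <= M * ip x x. Proof. by case: hB => _ _ /(_ x)/andP[]. Qed.

Local Notation Ar := (op_pow A 2^-1).
Local Notation Arn := (op_pow A (- 2^-1)).
Local Notation Ai := (op_pow A (- 1)).
Local Notation C := (Arn \o B \o Arn).

Let Arsa s : sadj (op_pow A s) := op_pow_sadj dotH m0 mM hA s.

Lemma op_inv_pow : op_inv A = Ai.
Proof. by apply: op_inv_eq; exact: (op_pow_inverse dotH m0 mM hA). Qed.

Let hAi : sa_between dot M^-1 m^-1 Ai := op_pow_inv_between dotH m0 mM hA.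
Let Mi0 : 0 < M^-1. Proof. by rewrite invr_gt0. Qed.
Let Mimi : M^-1 <= m^-1. Proof. by rewrite lef_pV2 ?posrE. Qed.

Let AiK x : A (Ai x) = x.
Proof. by have [_ []] := op_pow_inverse dotH m0 mM hA. Qed.

Lemma gmean_middle_between : sa_between dot (m / M) (M / m) C.
Proof.
apply: sa_between_conj (ltW m0) (ltW M0) (op_pow_bop dotH m0 mM hA _) _ hB _.
  exact: Arsa.
move=> x; rewrite Arsa (op_pow_Nhalf dotH m0 mM hA) ipC.
by case: hAi.
Qed.

(** [P] and [Q] stand for [A^(-1/2)] and [A^(1/2)], taken as powers of [A^-1] because [G = A^-1 # B]
    unfolds to [P (Q B Q)^(1/2) P]. *)
Local Notation P := (op_pow Ai 2^-1).
Local Notation Q := (op_pow Ai (- 2^-1)).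
Local Notation E := (Q \o B \o Q).
Local Notation D := (op_pow E 2^-1).
Local Notation G := (gmean 2^-1 Ai B).

Let Psa s : sadj (op_pow Ai s) := op_pow_sadj dotH Mi0 Mimi hAi s.

Let QQ x : Q (Q x) = A x.
Proof.
rewrite (op_pow_Nhalf dotH Mi0 Mimi hAi).
have [_ [h _]] := op_pow_inverse dotH Mi0 Mimi hAi.
have [_ [h' _]] := op_pow_inverse dotH m0 mM hA.
by rewrite -{1}(h' x) h.
Qed.

Let hE : sa_between dot (m * m) (M * M) E.
Proof.
apply: sa_between_conj (ltW m0) (ltW M0) (op_pow_bop dotH Mi0 Mimi hAi _) _ hB _.
  exact: Psa.
by move=> x; rewrite Psa QQ ipC A_ge A_le.
Qed.

Let mm0 : 0 < m * m. Proof. exact: mulr_gt0. Qed.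
Let mmMM : m * m <= M * M. Proof. by rewrite ler_pM// ltW. Qed.

Let hD : sa_between dot m M D.
Proof.
apply: (op_pow_between dotH mm0 mmMM hE) => r /andP[mr rM].
have r0 := lt_le_trans mm0 mr.
rewrite powR12_sqrt ?(ltW r0)//.
have sq c : 0 < c -> Num.sqrt (c * c) = c by move=> c0; rewrite -expr2 sqrtr_sqr gtr0_norm.
by have := ler_wsqrtr mr; have := ler_wsqrtr rM; rewrite !sq// => -> ->.
Qed.

Let GE x : G x = P (D (P x)). Proof. by []. Qed.

(** With [A = Q Q] and [P Q = Q P = 1], the product [G A G] collapses to [P D^2 P = P Q B Q P]. *)
Let G_riccati x : G (A (G x)) = B x.
Proof.
rewrite !GE -QQ !(op_powK dotH Mi0 Mimi hAi, op_powVK dotH Mi0 Mimi hAi).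
rewrite (op_pow_half dotH mm0 mmMM hE) /=.
by rewrite !(op_powK dotH Mi0 Mimi hAi, op_powVK dotH Mi0 Mimi hAi).
Qed.

Let PP_ge x : M^-1 * ip x x <= ip (P x) (P x) <= m^-1 * ip x x.
Proof. by rewrite Psa (op_pow_half dotH Mi0 Mimi hAi) ipC; case: hAi. Qed.

(** Crude bounds, sharpened to square roots below; they already give positivity and
    invertibility. *)
Let hG0 : sa_between dot (m * M^-1) (M * m^-1) G.
Proof.
apply: sa_between_conj (ltW m0) (ltW M0) (op_pow_bop dotH Mi0 Mimi hAi _) _ hD PP_ge.
exact: Psa.
Qed.

Let Gsa : sadj G. Proof. by case: hG0. Qed.
Let Gl : linear G. Proof. by case: hG0 => /bop_lin. Qed.

Let GAG x : ip (A (G x)) (G x) = ip (B x) x.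
Proof. by rewrite -Gsa G_riccati. Qed.

Let g1 := Num.sqrt (m / M).
Let g2 := Num.sqrt (M / m).
Let g1_gt0 : 0 < g1. Proof. by rewrite sqrtr_gt0 divr_gt0. Qed.
Let g2_gt0 : 0 < g2. Proof. by rewrite sqrtr_gt0 divr_gt0. Qed.

Let G_ge0 x : m / M * ip x x <= ip (G x) x.
Proof. by case: hG0 => _ _ /(_ x)/andP[]. Qed.

(** From [<A G y, G y> = <B y, y>] follows [m |y|^2 <= M |G y|^2] and [m |G y|^2 <= M |y|^2]. These
    norm bounds turn into form bounds, the lower one through [psd_lower_bound]. *)
Lemma gmean_inv_between : sa_between dot g1 g2 G.
Proof.
have mM_gt0 : 0 < m / M by rewrite divr_gt0.
split; [by case: hG0|exact: Gsa|move=> x; apply/andP; split].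
  have [S hS] : exists S, is_inverse G S.
    by apply: (coercive_inverse dotH _ Gsa mM_gt0) => //; case: hG0.
  apply: (psd_lower_bound dotH g1_gt0 Gl Gsa _ hS) => y.
    by rewrite (le_trans _ (G_ge0 y))// mulr_ge0 ?ip_ge0// ltW.
  rewrite mulrC -ler_pdivlMr// mulrC; apply: (nr_le_of_ip_le dotH).
    by rewrite invr_ge0 ltW.
  rewrite exprVn sqr_sqrtr ?(ltW mM_gt0)// invf_div mulrAC ler_pdivlMr//.
  have h1 := A_le (G y); have h2 := B_ge y; rewrite GAG in h1.
  by rewrite mulrC (le_trans h2).
apply: (form_le_norm dotH) => y; apply: (nr_le_of_ip_le dotH); first exact: ltW.
rewrite sqr_sqrtr ?divr_ge0 ?(ltW m0) ?(ltW M0)// mulrAC ler_pdivlMr// mulrC.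
by have h1 := A_ge (G y); rewrite GAG in h1; exact: le_trans h1 (B_le y).
Qed.

Let g12 : g1 <= g2.
Proof. by rewrite ler_wsqrtr// ler_pM ?invr_ge0 ?(ltW m0) ?(ltW M0). Qed.

(** * Form estimates for the two weighted means *)

Variable t : R.
Hypotheses (t0 : 0 <= t) (t1 : t <= 1).
Let t01 : 0 <= t <= 1. Proof. by rewrite t0 t1. Qed.

Local Notation U := (op_pow G t).

Let hU : sa_between dot (g1 `^ t) (g2 `^ t) U.
Proof.
apply: (op_pow_between dotH g1_gt0 g12 gmean_inv_between) => r /andP[gr rg].
have r0 := lt_le_trans g1_gt0 gr.
by rewrite !ge0_ler_powR// ?nnegrE ?(ltW r0) ?(ltW g1_gt0) ?(ltW g2_gt0).
Qed.

Let Usa : sadj U. Proof. by case: hU. Qed.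

Let hY : sa_between dot (g1 `^ t * m) (g2 `^ t * M) (Ar \o U \o Ar).
Proof.
apply: sa_between_conj (powR_ge0 _ _) (powR_ge0 _ _) (op_pow_bop dotH m0 mM hA _) _ hU _.
  exact: Arsa.
by move=> x; rewrite Arsa (op_pow_half dotH m0 mM hA) ipC A_ge A_le.
Qed.

Let kappa := (M `^ (1 + t) + m `^ (1 + t)) ^+ 2 / (4 * M `^ (1 + t) * m `^ (1 + t)).

(** The Kantorovich factor depends only on the ratio of the bounds, here [(M / m)^(1 + t)]. *)
Let kappaE : (g1 `^ t * m + g2 `^ t * M) ^+ 2 / (4 * (g1 `^ t * m) * (g2 `^ t * M)) = kappa.
Proof.
rewrite /kappa /g1 /g2; set u := Num.sqrt m; set v := Num.sqrt M.
have u0 : 0 < u by rewrite sqrtr_gt0.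
have v0 : 0 < v by rewrite sqrtr_gt0.
have pw c : 0 < c -> c `^ (1 + t) = c * (Num.sqrt c `^ t) ^+ 2.
  move=> c0; rewrite powRD ?(gt_eqF c0) ?implybT// powRr1 ?(ltW c0)//.
  by rewrite expr2 -powRM ?sqrtr_ge0// -expr2 sqr_sqrtr// ltW.
have quot c d : 0 < c -> 0 < d ->
    Num.sqrt (c / d) `^ t = Num.sqrt c `^ t / Num.sqrt d `^ t.
  move=> c0 d0; have sc : 0 < Num.sqrt c by rewrite sqrtr_gt0.
  have sd : 0 < Num.sqrt d by rewrite sqrtr_gt0.
  rewrite sqrtrM ?(ltW c0)// sqrtrV ?(ltW d0)// powRM ?invr_ge0 ?ltW//.
  by rewrite -(powR_inv1 (ltW sd)) -powRrM mulN1r powRN.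
rewrite !pw// !quot// -/u -/v.
have : 0 < u `^ t by exact: powR_gt0.
have : 0 < v `^ t by exact: powR_gt0.
move: (u `^ t) (v `^ t) => p q q0 p0.
by field; rewrite !gt_eqF.
Qed.

(** Kantorovich for [Y = A^(1/2) U A^(1/2)] at [y = A^(-1/2) x], where [Y y = A^(1/2) U x],
    [<Y y, y> = <U x, x>] and [|y|^2 = <A^-1 x, x>]. *)
Lemma spectral_gmean_kantorovich x :
  ip (A (U x)) (U x) * ip (Ai x) x <= kappa * ip (U x) x ^+ 2.
Proof.
have hY0 : 0 < g1 `^ t * m by rewrite mulr_gt0// powR_gt0.
have hY1 : g1 `^ t * m <= g2 `^ t * M.
  by rewrite ler_pM ?powR_ge0// ?(ltW m0)// ge0_ler_powR// ?nnegrE ltW.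
have := kantorovich_vector dotH (Arn x) hY0 hY1 hY; rewrite kappaE /=.
rewrite (op_powK dotH m0 mM hA) !Arsa (op_pow_half dotH m0 mM hA).
rewrite (op_powK dotH m0 mM hA) (op_pow_Nhalf dotH m0 mM hA) => h.
by rewrite Asa.
Qed.

(** Jensen's inequality: the tangent of [r^t] at [s = <G x, x> / |x|^2] lies above the power, and
    its operator has form [s^t |x|^2] at [x]. *)
Lemma spectral_gmean_pow_le x : 0 < ip x x ->
  ip (U x) x <= ip x x * (ip (G x) x / ip x x) `^ t.
Proof.
move=> x0; have Gx0 : 0 < ip (G x) x.
  by rewrite (lt_le_trans _ (G_ge0 x))// mulr_gt0// divr_gt0.
have s0 := divr_gt0 Gx0 x0; set s := ip (G x) x / ip x x in s0 *.
have tan r : g1 <= r <= g2 -> r `^ t <= t * (s `^ t / s) * r + (1 - t) * s `^ t.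
  by move=> /andP[gr _]; apply: powR_tangent => //; exact: lt_le_trans gr.
apply: le_trans (op_pow_affine_le dotH g1_gt0 g12 gmean_inv_between tan x) _.
have -> : ip (G x) x = s * ip x x by rewrite /s divfK// gt_eqF.
by rewrite le_eqVlt; apply/orP; left; apply/eqP; field; rewrite gt_eqF.
Qed.

Let Ai_gt0 x : 0 < ip x x -> 0 < ip (Ai x) x.
Proof.
move=> x0; case: hAi => _ _ /(_ x)/andP[h _].
by rewrite (lt_le_trans _ h)// mulr_gt0.
Qed.

Let A_psd x : 0 <= ip (A x) x.
Proof. by rewrite (le_trans _ (A_ge x))// mulr_ge0 ?ip_ge0// ltW. Qed.

(** Cauchy-Schwarz for the form of [A] at [G x] and [A^-1 x]. *)
Lemma gmean_inv_form_sqr_le x : ip (G x) x ^+ 2 <= ip (B x) x * ip (Ai x) x.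
Proof.
have := psd_CauchySchwarz (G x) (Ai x) Al Asa A_psd.
by rewrite Asa AiK GAG (ipC _ x).
Qed.

Lemma norm_sqr_le_inv_form x : ip x x ^+ 2 <= ip (A x) x * ip (Ai x) x.
Proof.
have := psd_CauchySchwarz x (Ai x) Al Asa A_psd.
by rewrite Asa AiK (ipC _ x (Ai x)).
Qed.

Let K := kantorovich (m / M) (M / m) t.

Let mMMm : m / M <= M / m.
Proof. by rewrite ler_pM ?invr_ge0 ?(ltW m0) ?(ltW M0). Qed.

Let K_gt0 : 0 < K.
Proof. by have [] := kantorovich_chord (divr_gt0 m0 M0) mMMm t01. Qed.

Lemma gmeanE x : ip (gmean t A B x) x = ip (op_pow C t (Ar x)) (Ar x).
Proof. by rewrite /gmean /= Arsa. Qed.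

(** At [y = A^(1/2) x] one has [<C y, y> = <B x, x>] and [|y|^2 = <A x, x>]. The chord bounds [C^t]
    from below as an operator, and at the scalar [<B x, x> / <A x, x>] it dominates [K r^t]. *)
Lemma gmean_ge x : 0 < ip x x ->
  K * (ip (A x) x * (ip (B x) x / ip (A x) x) `^ t) <= ip (gmean t A B x) x.
Proof.
move=> x0; have mM0 := divr_gt0 m0 M0.
have [_ [c [d [h1 h2]]]] := kantorovich_chord mM0 mMMm t01.
have yy : ip (Ar x) (Ar x) = ip (A x) x by rewrite Arsa (op_pow_half dotH m0 mM hA) ipC.
have Cy : ip (C (Ar x)) (Ar x) = ip (B x) x.
  by rewrite /= Arsa !(op_powVK dotH m0 mM hA).
have A0 : 0 < ip (A x) x by rewrite (lt_le_trans _ (A_ge x))// mulr_gt0.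
have Cb := gmean_middle_between.
have := op_pow_affine_ge dotH mM0 mMMm Cb h1 (Ar x).
rewrite gmeanE Cy yy; apply: le_trans.
have u12 : m / M <= ip (B x) x / ip (A x) x <= M / m.
  case: Cb => _ _ /(_ (Ar x)); rewrite Cy yy => /andP[? ?].
  by rewrite ler_pdivlMr// ler_pdivrMr//; apply/andP.
have := h2 _ u12; rewrite -(ler_pM2l A0) => h.
rewrite mulrCA (le_trans h)// le_eqVlt; apply/orP; left; apply/eqP.
by field; rewrite gt_eqF.
Qed.

Lemma spectral_gmean_le x :
  ip (A (U x)) (U x) <= 1 / K * kappa * ip (gmean t A B x) x.
Proof.
have [x0|x0] := eqVneq (ip x x) 0.
  have -> := ip_eq0 dotH x0.
  by have [/bop_lin Ul _ _] := hU; rewrite (lin0 Ul) !ip0r mulr0.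
have {}x0 : 0 < ip x x by rewrite lt_neqAle eq_sym x0 ip_ge0.
have i0 := Ai_gt0 x0.
have A0 : 0 < ip (A x) x by rewrite (lt_le_trans _ (A_ge x))// mulr_gt0.
have B0 : 0 < ip (B x) x by rewrite (lt_le_trans _ (B_ge x))// mulr_gt0.
have G0 : 0 < ip (G x) x.
  by rewrite (lt_le_trans _ (G_ge0 x))// mulr_gt0// divr_gt0.
have U0 : 0 <= ip (U x) x.
  by case: hU => _ _ /(_ x)/andP[h _]; rewrite (le_trans _ h)// mulr_ge0 ?powR_ge0// ltW.
have kappa0 : 0 <= kappa.
  by rewrite divr_ge0 ?sqr_ge0// !mulr_ge0 ?powR_ge0.
have h1 := spectral_gmean_kantorovich x.
have h2 : ip (U x) x ^+ 2 <= (ip x x * (ip (G x) x / ip x x) `^ t) ^+ 2.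
  have h := spectral_gmean_pow_le x0.
  by rewrite ler_sqr ?nnegrE// (le_trans U0).
have h3 := powR_combine t01 A0 B0 i0 x0 G0 (norm_sqr_le_inv_form x) (gmean_inv_form_sqr_le x).
have h4 := gmean_ge x0.
move: h3 h4; set W := ip (A x) x * _ => h3 h4.
(* The positive factor [<A^-1 x, x>], common to both sides, cancels. *)
have h5 : ip (A (U x)) (U x) <= kappa * W.
  rewrite -(ler_pM2r i0) (le_trans h1)// -(mulrA kappa) ler_wpM2l// (mulrC W).
  exact: le_trans h2 h3.
rewrite (le_trans h5)// mul1r (mulrC K^-1) -(mulrA kappa) ler_wpM2l//.
by rewrite (mulrC K^-1) ler_pdivlMr// (mulrC W).
Qed.

Lemma spectral_gmean_sadj : sadj (spectral_gmean t A B).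
Proof. by move=> x y; rewrite /spectral_gmean op_inv_pow /= Usa Asa Usa. Qed.

Lemma gmean_sadj : sadj (gmean t A B).
Proof.
move=> x y; rewrite /gmean /= Arsa.
have Cb := gmean_middle_between; have mM0 := divr_gt0 m0 M0.
by rewrite (op_pow_sadj dotH mM0 mMMm Cb) Arsa.
Qed.

Lemma spectral_gmean_form_le x :
  ip (spectral_gmean t A B x) x <= 1 / K * kappa * ip (gmean t A B x) x.
Proof. by rewrite /spectral_gmean op_inv_pow /= Usa spectral_gmean_le. Qed.

Lemma gmean_bop : bounded_op (gmean t A B).
Proof.
have Cb := gmean_middle_between; have mM0 := divr_gt0 m0 M0.
apply: bop_comp; last exact: (op_pow_bop dotH m0 mM hA).
apply: bop_comp; first exact: (op_pow_bop dotH m0 mM hA).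
exact: (op_pow_bop dotH mM0 mMMm Cb).
Qed.

Lemma spectral_gmean_bop : bounded_op (spectral_gmean t A B).
Proof.
rewrite /spectral_gmean op_inv_pow /=; have [Ub _ _] := hU; have [Ab _ _] := hA.
by apply: bop_comp => //; apply: bop_comp.
Qed.

End SpectralGeometricMean.

(** * Passage between the operator order and real quadratic forms *)

Section Order.
Context {R : realType} {H : completeNormedModType R[i]}.
Variable dot : {dot H for Num.conj}.
Implicit Types (S T : H -> H).

Lemma self_adjointP T : linear T -> self_adjoint dot T <-> sadj dot T.
Proof.
move=> Tl; split=> h x y; first by rewrite /ip h.
by rewrite !dotE -(linZ Tl) !h.
Qed.

Lemma psd_sadj T : psd dot T -> sadj dot T.
Proof. by case=> h _ x y; rewrite /ip h. Qed.

Lemma psd_ge0 T x : psd dot T -> 0 <= ip dot (T x) x.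
Proof. by case=> _ /(_ x); rewrite lecE => /andP[]. Qed.

Lemma psd_of_sadj T : linear T -> sadj dot T -> (forall x, 0 <= ip dot (T x) x) ->
  psd dot T.
Proof.
move=> Tl /(self_adjointP Tl) Ts T0; split=> // x.
rewrite lecE; apply/andP; split; last exact: T0.
(* Self-adjointness makes [dot (T x) x] equal to its conjugate, so its imaginary part vanishes. *)
have : dot (T x) x = (dot (T x) x)^*%C by rewrite {1}Ts hermC /= expr0 mul1r.
by case: (dot (T x) x) => u v [] /= h; apply/eqP; lra.
Qed.

Lemma sa_between_of_op_le a b T : bounded_op T ->
  op_le dot (a%:C *: (idfun : H -> H)) T -> op_le dot T (b%:C *: (idfun : H -> H)) ->
  sa_between dot a b T.
Proof.
move=> Tb aT Tb'; split=> // [x y|x].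
  by have := psd_sadj aT x y; rewrite shiftE !ipE; lra.
have := psd_ge0 x aT; have := psd_ge0 x Tb'.
rewrite !addrfctE !opprfctE !scalrfctE /= !ipBl !ipZl; lra.
Qed.

End Order.

Theorem corollary2p2 (R : realType) (H : completeNormedModType R[i])
    (dot : {dot H for Num.conj}) (dotH : induces_norm dot)
    (A B : H -> H) (A_bounded : bounded_op A) (B_bounded : bounded_op B)
    (m M : R) (m_gt0 : 0 < m)
    (mA : op_le dot (m%:C *: (idfun : H -> H)) A)
    (AM : op_le dot A (M%:C *: (idfun : H -> H)))
    (mB : op_le dot (m%:C *: (idfun : H -> H)) B)
    (BM : op_le dot B (M%:C *: (idfun : H -> H)))
    (t : R) (t_ge0 : 0 <= t) (t_le1 : t <= 1) :
  op_le dot (spectral_gmean t A B)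
    ((1 / kantorovich (m / M) (M / m) t *
      ((M `^ (1 + t) + m `^ (1 + t)) ^+ 2 /
       (4 * M `^ (1 + t) * m `^ (1 + t))))%:C *: gmean t A B).
Proof.
have hA := sa_between_of_op_le A_bounded mA AM.
have hB := sa_between_of_op_le B_bounded mB BM.
(* In the zero space all forms vanish; otherwise the bounds on [A] at a nonzero vector give
   [m <= M]. *)
have [[x x0]|H0] := pselect (exists x : H, x != 0); last first.
  have z (x : H) : x = 0 by apply/eqP/negPn/negP => xn; apply: H0; exists x.
  by split=> [x y|x]; rewrite (z (_ x)) linear0l ?(z x) ?linear0l.
have mM : m <= M.
  have x1 : 0 < ip dot x x.
    rewrite lt_neqAle ip_ge0// andbT eq_sym; apply: contra x0 => /eqP h.
    by apply/eqP; exact: ip_eq0 h.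
  have [_ _ /(_ x)/andP[h1 h2]] := hA.
  by rewrite -(ler_pM2r x1) (le_trans h1).
set c := 1 / _ * _.
have gb := gmean_bop dotH m_gt0 mM hA hB t.
have sb := spectral_gmean_bop dotH m_gt0 mM hA hB t_ge0.
apply: psd_of_sadj.
- by apply: bop_lin; apply: bopB => //; exact: bopZ.
- move=> y z; rewrite !addrfctE !opprfctE !scalrfctE !ipE.
  rewrite (gmean_sadj dotH m_gt0 mM hA hB t y z).
  by rewrite (spectral_gmean_sadj dotH m_gt0 mM hA hB t_ge0 y z).
move=> y; rewrite !addrfctE !opprfctE !scalrfctE ipBl ipZl subr_ge0.
exact: spectral_gmean_form_le.
Qed.
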